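(* $\mathrm{FO}(\mathrm H)\le\mathrm{ESO}_{\mathbb R}(+,\times,\log)$ and $\mathrm{FO}(\mathrm H,\sim)\le\mathrm{SO}_{\mathbb R}(+,\times,\log)$; that is, for every $\mathrm{FO}(\mathrm H)$-formula (resp. $\mathrm{FO}(\mathrm H,\sim)$-formula) $\phi$ with free variables among $\bar v=(v_1,\dots,v_k)$ there is an $\mathrm{ESO}_{\mathbb R}(+,\times,\log)$-formula (resp. $\mathrm{SO}_{\mathbb R}(+,\times,\log)$-formula) $\psi_\phi(f)$ with a single free $k$-ary function variable $f$ such that for all finite structures $\mathcal A$ and probabilistic teams $\mathbb X$ over $\{v_1,\dots,v_k\}$: $\mathcal A\models_{\mathbb X}\phi$ iff $(\mathcal A,f_{\mathbb X})\models\psi_\phi(f)$.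
   Context: Probabilistic team semantics. Structures $\mathcal A$ are finite with universe $A$. An assignment over a finite set $D$ of variables is $s\colon D\to A$; $s(a/x)$ maps $x$ to $a$ and agrees with $s$ elsewhere. A probabilistic team over $D$ is $\mathbb X\colon X\to[0,1]$ with $\sum_{s\in X}\mathbb X(s)=1$, $X$ a finite set of assignments over $D$; $\mathrm{supp}(\mathbb X)=\{s:\mathbb X(s)\ne0\}$; $|\mathbb X_{\bar x=\bar a}|=\sum_{s(\bar x)=\bar a}\mathbb X(s)$. $\mathbb X(F/x)(s(a/x))=\sum_{t\in X,\ t(a/x)=s(a/x)}\mathbb X(t)F(t)(a)$ for $F$ assigning to each $t\in X$ a distribution on $A$; $\mathbb X(A/x)$ uses uniform $F(t)$; $\mathbb Y\sqcup_k\mathbb Z$ is $s\mapsto k\mathbb Y(s)+(1-k)\mathbb Z(s)$. Semantics: first-order literals hold in $\mathbb X$ iff every $s\in\mathrm{supp}(\mathbb X)$ satisfies them; $\wedge$ classical; $\phi\vee\psi$ holds in $\mathbb X$ iff $\phi$ holds in $\mathbb Y$ and $\psi$ in $\mathbb Z$ for some $\mathbb Y,\mathbb Z,k$ with $\mathbb Y\sqcup_k\mathbb Z=\mathbb X$; $\exists x\phi$ holds iff $\phi$ holds in some $\mathbb X(F/x)$; $\forall x\phi$ holds iff $\phi$ holds in $\mathbb X(A/x)$; $\sim\phi$ holds iff $\phi$ does not. $\mathrm{FO}(\mathrm H)$ is first-order logic with these semantics extended by entropy atoms $\mathrm H(\bar x)=\mathrm H(\bar y)$, holding iff $\mathrm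 H_{\mathbb X}(\bar x)=\mathrm H_{\mathbb X}(\bar y)$, where $\mathrm H_{\mathbb X}(\bar x)=-\sum_{\bar a}P(\bar a)\log_2P(\bar a)$, $P(\bar a)=|\mathbb X_{\bar x=\bar a}|$, $0\log0=0$; $\mathrm{FO}(\mathrm H,\sim)$ additionally allows $\sim$. $\mathrm{SO}_{\mathbb R}(+,\times,\log)$: over $\mathbb R$-structures (finite structures expanded by functions $A^{\mathrm{Ar}(f)}\to\mathbb R$), numerical terms built from $f(\bar x)$ using $+,\times,\log$; formulas $i=j\mid\neg i=j\mid R(\bar x)\mid\neg R(\bar x)\mid\wedge\mid\vee\mid\exists x\mid\forall x\mid\exists f\mid\forall f$, function quantifiers ranging over all functions into $\mathbb R$; $\mathrm{ESO}_{\mathbb R}$ forbids $\forall f$. For a team $\mathbb X$ over $\{v_1,\dots,v_k\}$, $f_{\mathbb X}\colon A^k\to[0,1]$ is given by $f_{\mathbb X}(s(\bar v))=\mathbb X(s)$ (and $0$ on tuples not arising from $X$).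
   Formalization: The target logics are taken with first-order literals x=y and ¬x=y, absent from the listed grammar; without them the ESO claim fails for ∀x∀y x=y, since equality-free ESO sentences true in a one-element structure stay true in a two-element one. *)

(* Defs.v *)
From HB Require Import structures.
From mathcomp Require Import all_boot all_order all_algebra.
From mathcomp Require Import reals exp Rstruct.
From Stdlib Require Import Rdefinitions.

Set Implicit Arguments.
Unset Strict Implicit.
Unset Printing Implicit Defensive.
Import Order.TTheory GRing.Theory Num.Theory.
Local Open Scope ring_scope.

Notation R := Rdefinitions.R.

(* base-2 logarithm; as [ln], it is 0 on non-positive arguments
   (so in particular 0 log 0 = 0) *)
Definition log2 (x : R) : R := ln x / ln 2.

Section Vocab.
Variables (sym : Type) (ar : sym -> nat).

Record structure := Structure {
  dom : finType;
  rel : forall r : sym, pred ((ar r).-tuple dom) }.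

Section FOH.
Variable N : nat.

Inductive fform :=
| FEq of 'I_N & 'I_N
| FNeq of 'I_N & 'I_N
| FRel (r : sym) of (ar r).-tuple 'I_N
| FNRel (r : sym) of (ar r).-tuple 'I_N
| FH of seq 'I_N & seq 'I_N
| FAnd of fform & fform
| FOr of fform & fform
| FEx of 'I_N & fform
| FAll of 'I_N & fform
| FNot of fform.

Fixpoint is_FOH (phi : fform) : bool :=
  match phi with
  | FAnd p q | FOr p q => is_FOH p && is_FOH q
  | FEx _ p | FAll _ p => is_FOH p
  | FNot _ => false
  | _ => true
  end.

Fixpoint fv (phi : fform) : {set 'I_N} :=
  match phi with
  | FEq x y | FNeq x y => [set x; y]
  | FRel _ xs | FNRel _ xs => [set x in xs]
  | FH xs ys => [set x in xs ++ ys]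
  | FAnd p q | FOr p q => fv p :|: fv q
  | FEx x p | FAll x p => fv p :\ x
  | FNot p => fv p
  end.

(* An assignment with domain D is a finite function 'I_N -> option A     *)
(* which is Some exactly on D.  A probabilistic team over D is a         *)
(* function from assignments to reals, nonnegative, summing to 1, whose *)
(* support consists of assignments with domain D (weight 0 = outside X).*)

Section Sem.
Variable A : structure.
Let T := dom A.

Definition asg := {ffun 'I_N -> option T}.

Definition is_team (D : {set 'I_N}) (X : asg -> R) : Prop :=
  [/\ forall s, 0 <= X s,
      \sum_(s : asg) X s = 1 &
      forall s, X s != 0 -> forall i, (s i != None) = (i \in D)].

Definition upd (s : asg) (x : 'I_N) (a : T) : asg :=
  [ffun i => if i == x then Some a else s i].

Definition ext (X : asg -> R) (x : 'I_N) (F : asg -> T -> R) : asg -> R :=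
  fun u => \sum_(s : asg) \sum_(a : T) (if u == upd s x a then X s * F s a else 0).

Definition ext_all (X : asg -> R) (x : 'I_N) : asg -> R :=
  ext X x (fun _ _ => (#|T|%:R)^-1).

Definition marg (X : asg -> R) (xs : seq 'I_N) (a : seq T) : R :=
  \sum_(s : asg) (if [seq s x | x <- xs] == map Some a then X s else 0).

Definition entropy (X : asg -> R) (xs : seq 'I_N) : R :=
  - \sum_(a : (size xs).-tuple T) marg X xs a * log2 (marg X xs a).

Definition lit_eq (s : asg) x y := s x != None /\ s x = s y.
Definition lit_neq (s : asg) x y := s x != None /\ s y != None /\ s x <> s y.
Definition lit_rel (s : asg) r (xs : (ar r).-tuple 'I_N) (b : bool) :=
  exists t : (ar r).-tuple T, map Some t = [seq s x | x <- xs] /\ rel t = b.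

Fixpoint sat (D : {set 'I_N}) (phi : fform) (X : asg -> R) : Prop :=
  match phi with
  | FEq x y => forall s, X s != 0 -> lit_eq s x y
  | FNeq x y => forall s, X s != 0 -> lit_neq s x y
  | FRel r xs => forall s, X s != 0 -> lit_rel s xs true
  | FNRel r xs => forall s, X s != 0 -> lit_rel s xs false
  | FH xs ys => entropy X xs = entropy X ys
  | FAnd p q => sat D p X /\ sat D q X
  | FOr p q => exists (Y Z : asg -> R) (k : R),
      [/\ is_team D Y /\ is_team D Z, 0 <= k <= 1,
          forall s, X s = k * Y s + (1 - k) * Z s,
          sat D p Y & sat D q Z]
  | FEx x p => exists F : asg -> T -> R,
      (forall s, (forall a, 0 <= F s a) /\ \sum_a F s a = 1) /\
      sat (x |: D) p (ext X x F)
  | FAll x p => sat (x |: D) p (ext_all X x)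
  | FNot p => ~ sat D p X
  end.

End Sem.
End FOH.

(* First-order variables and function variables are named by nat.      *)
(* A function variable is interpreted by a pair (arity m, g) where only *)
(* the values of g on lists of length m matter (g restricted to A^m).   *)

Inductive sterm :=
| TApp of nat & seq nat
| TAdd of sterm & sterm
| TMul of sterm & sterm
| TLog of sterm.

Inductive sform :=
| SEqT of sterm & sterm
| SNeqT of sterm & sterm
| SEqV of nat & nat
| SNeqV of nat & nat
| SRel (r : sym) of (ar r).-tuple nat
| SNRel (r : sym) of (ar r).-tuple nat
| SAnd of sform & sform
| SOr of sform & sform
| SEx of nat & sform
| SAll of nat & sform
| SExF of nat & nat & sform
| SAllF of nat & nat & sform.

Fixpoint is_ESO (psi : sform) : bool :=
  match psi with
  | SAnd p q | SOr p q => is_ESO p && is_ESO q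
  | SEx _ p | SAll _ p | SExF _ _ p => is_ESO p
  | SAllF _ _ _ => false
  | _ => true
  end.

Fixpoint tvar (t : sterm) (x : nat) : bool :=
  match t with
  | TApp _ xs => x \in xs
  | TAdd t1 t2 | TMul t1 t2 => tvar t1 x || tvar t2 x
  | TLog t1 => tvar t1 x
  end.

Fixpoint tfun (t : sterm) (f : nat) : bool :=
  match t with
  | TApp g _ => g == f
  | TAdd t1 t2 | TMul t1 t2 => tfun t1 f || tfun t2 f
  | TLog t1 => tfun t1 f
  end.

Fixpoint sfree_var (psi : sform) (x : nat) : bool :=
  match psi with
  | SEqT t1 t2 | SNeqT t1 t2 => tvar t1 x || tvar t2 x
  | SEqV y z | SNeqV y z => (x == y) || (x == z)
  | SRel _ ys | SNRel _ ys => x \in ys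
  | SAnd p q | SOr p q => sfree_var p x || sfree_var q x
  | SEx y p | SAll y p => (x != y) && sfree_var p x
  | SExF _ _ p | SAllF _ _ p => sfree_var p x
  end.

Fixpoint sfree_fun (psi : sform) (f : nat) : bool :=
  match psi with
  | SEqT t1 t2 | SNeqT t1 t2 => tfun t1 f || tfun t2 f
  | SEqV _ _ | SNeqV _ _ | SRel _ _ | SNRel _ _ => false
  | SAnd p q | SOr p q => sfree_fun p f || sfree_fun q f
  | SEx _ p | SAll _ p => sfree_fun p f
  | SExF g _ p | SAllF g _ p => (f != g) && sfree_fun p f
  end.

Section SSem.
Variable A : structure.
Let T := dom A.

Definition fenv := nat -> (nat * (seq T -> R)).

Definition supd (s : nat -> T) (x : nat) (a : T) : nat -> T :=
  fun y => if y == x then a else s y.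

Definition fupd (rho : fenv) (f : nat) (v : nat * (seq T -> R)) : fenv :=
  fun g => if g == f then v else rho g.

Fixpoint teval (s : nat -> T) (rho : fenv) (t : sterm) : R :=
  match t with
  | TApp f xs => if size xs == (rho f).1 then (rho f).2 (map s xs) else 0
  | TAdd t1 t2 => teval s rho t1 + teval s rho t2
  | TMul t1 t2 => teval s rho t1 * teval s rho t2
  | TLog t1 => log2 (teval s rho t1)
  end.

Fixpoint ssat (s : nat -> T) (rho : fenv) (psi : sform) : Prop :=
  match psi with
  | SEqT t1 t2 => teval s rho t1 = teval s rho t2
  | SNeqT t1 t2 => teval s rho t1 <> teval s rho t2
  | SEqV x y => s x = s y
  | SNeqV x y => s x <> s y
  | SRel r xs => rel (map_tuple s xs)
  | SNRel r xs => ~~ rel (map_tuple s xs)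
  | SAnd p q => ssat s rho p /\ ssat s rho q
  | SOr p q => ssat s rho p \/ ssat s rho q
  | SEx x p => exists a : T, ssat (supd s x a) rho p
  | SAll x p => forall a : T, ssat (supd s x a) rho p
  | SExF f m p => exists g : seq T -> R, ssat s (fupd rho f (m, g)) p
  | SAllF f m p => forall g : seq T -> R, ssat s (fupd rho f (m, g)) p
  end.

Definition smodels (k : nat) (f : seq T -> R) (psi : sform) : Prop :=
  forall (s : nat -> T) (rho : fenv), rho 0%N = (k, f) -> ssat s rho psi.

Definition asg_of N (vs : seq 'I_N) (a : seq T) : asg N A :=
  [ffun i => if i \in vs then nth None (map Some a) (index i vs) else None].

Definition f_team N k (vs : k.-tuple 'I_N) (X : asg N A -> R) : seq T -> R :=
  fun a => if size a == k then X (asg_of vs a) else 0.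

End SSem.

Definition one_free_fun (psi : sform) : Prop :=
  (forall x, ~~ sfree_var psi x) /\ (forall f, sfree_fun psi f -> f = 0%N).

End Vocab.

(* Main.v *)
Require Import Defs.
From HB Require Import structures.
From mathcomp Require Import all_boot all_order all_algebra.
From mathcomp Require Import reals exp Rstruct.
From mathcomp Require Import boolp lra zify.

(* A team over the variables vs is coded by a function on |vs|-tuples of the
   universe.  The only operation missing from the target logic is summation over
   the universe.  It is recovered by guessing a linear order of the universe
   together with the running sums of the summand: these are forced to be correct
   at the first element and along successors, and are compared with the claimed
   total at the last element.  Iterating gives sums over tuples, hence marginals,
   entropies and the normalisation of teams.  The inequality 0 <= t is expressed
   by guessing a square root of t.

   An existential team quantifier guesses the extended team instead of the
   distributions F: a team Y has the form X(F/x) iff X and Y have the same mass on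
   every class of assignments that agree off x, F being then recovered as a
   conditional distribution.  A universal one is the same with uniform
   weights.  Finally ~ is interpreted by the dual formula. *)

Set Implicit Arguments.
Unset Strict Implicit.
Unset Printing Implicit Defensive.
Import Order.TTheory GRing.Theory Num.Theory.
Local Open Scope ring_scope.

(** * Sums over a finite universe *)

Section RunningSum.
Variables (T : finType) (lt : rel T).
Hypotheses (lt_irr : irreflexive lt) (lt_trans : transitive lt).
Hypothesis lt_total : forall x y, [\/ x = y, lt x y | lt y x].

Definition running_sum (h : T -> R) (x : T) : R := \sum_(y | (y == x) || lt y x) h y.

(** The rank of [x] in the order. It turns induction along [lt] into induction on numbers and lets
    extremal elements be found by maximising it. *)
Let height x := #|[set y | lt y x]|.

Let height_mono x y : lt x y -> (height x < height y)%N.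
Proof.
move=> xy; apply: proper_card; apply/properP; split.
  by apply/subsetP=> z; rewrite !inE => /lt_trans; exact.
by exists x; rewrite !inE ?lt_irr.
Qed.

Lemma running_sum_first h x : (forall w, ~~ lt w x) -> running_sum h x = h x.
Proof.
move=> nx; rewrite /running_sum (bigD1 x) ?eqxx //= big1 ?addr0 // => y.
by rewrite (negbTE (nx y)) orbF andbN.
Qed.

(** Since nothing lies strictly between [y] and [x], the elements strictly below [x] are exactly
    those up to [y]. *)
Lemma running_sum_succ h x y :
  lt y x -> (forall w, ~~ (lt y w && lt w x)) ->
  running_sum h x = running_sum h y + h x.
Proof.
move=> yx nw; rewrite /running_sum (bigD1 x) ?eqxx //= addrC; congr (_ + _).
apply: eq_bigl => z; apply/idP/idP.
  case/andP=> /orP[/eqP->|zx nzx]; first by rewrite eqxx.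
  case: (lt_total z y) => [->|->|yz]; rewrite ?eqxx ?orbT //.
  by move: (nw z); rewrite yz zx.
case/orP=> [/eqP->|zy].
  rewrite yx orbT; apply/eqP=> E; by rewrite E lt_irr in yx.
have zx := lt_trans zy yx.
by rewrite zx orbT; apply/eqP=> E; rewrite E lt_irr in zx.
Qed.

Lemma running_sum_last h x : (forall w, ~~ lt x w) -> running_sum h x = \sum_y h y.
Proof.
move=> nx; apply: eq_bigl => y.
case: (lt_total y x) => [->|->|xy]; rewrite ?eqxx ?orbT //.
by rewrite (negbTE (nx y)) in xy.
Qed.

(** The hypotheses have the disjunctive shape of the clauses of [sum_is]. Induction on the rank
    applies the first clause at a minimal element and the second one at an immediate predecessor. *)
Lemma running_sum_unique (h c : T -> R) :
  (forall x, (exists w, lt w x) \/ c x = h x) ->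
  (forall x y, [\/ ~~ lt y x, exists w, lt y w && lt w x | c x = c y + h x]) ->
  c =1 running_sum h.
Proof.
move=> cf cs x; move: {2}(height x) (leqnn (height x)) => n.
elim: n x => [|n IH] x hx.
  have nx w : ~~ lt w x.
    by apply/negP=> /height_mono; rewrite ltnNge (leq_trans hx).
  rewrite running_sum_first //; case: (cf x) => // -[w].
  by rewrite (negbTE (nx w)).
case: (pickP (lt^~ x)) => [w wx|nx]; last first.
  rewrite running_sum_first => [|w]; last by rewrite nx.
  by case: (cf x) => // -[w]; rewrite nx.
(* An element of greatest rank below [x] is an immediate predecessor of [x]. *)
have [y yx ymax] := @arg_maxnP _ w (lt^~ x) height wx.
have nw z : ~~ (lt y z && lt z x).
  apply/negP=> /andP[/height_mono yz zx].
  by move: (ymax z zx); rewrite /= leqNgt yz.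
rewrite (running_sum_succ _ yx nw) -IH; last first.
  by rewrite -ltnS (leq_trans (height_mono yx)).
case: (cs x y) => [|[z]|//]; first by rewrite yx.
by rewrite (negbTE (nw z)).
Qed.

Lemma exists_last (x0 : T) : exists x, forall w, ~~ lt x w.
Proof.
have [y _ ymax] := @arg_maxnP _ x0 predT height isT.
exists y => w; apply/negP=> /height_mono yw.
by move: (ymax w isT); rewrite /= leqNgt yw.
Qed.

End RunningSum.

(** * Splitting off the first entry in sums over tuples *)

Section Tuples.
Variable T : finType.

Lemma sum_tuple_cons n (G : seq T -> R) :
  \sum_(a : n.+1.-tuple T) G a = \sum_(x : T) \sum_(a : n.-tuple T) G (x :: a).
Proof.
rewrite pair_big /= (reindex (fun p : T * n.-tuple T => [tuple of p.1 :: p.2])) //=.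
exists (fun a => (thead a, [tuple of behead a])) => [[x a] _|a _] /=.
  by congr (_, _); apply: val_inj.
by rewrite [RHS]tuple_eta; apply: val_inj.
Qed.

End Tuples.

(** * Building blocks of the target formulas *)

Section Formulas.
Variables (sym : Type) (ar : sym -> nat).

Local Notation sform := (sform ar).

(** Negation is available on atoms only, so it is pushed through to them. *)
Fixpoint dual (p : sform) : sform :=
  match p with
  | SEqT t u => SNeqT ar t u
  | SNeqT t u => SEqT ar t u
  | SEqV x y => SNeqV ar x y
  | SNeqV x y => SEqV ar x y
  | SRel r xs => SNRel xs
  | SNRel r xs => SRel xs
  | SAnd p q => SOr (dual p) (dual q)
  | SOr p q => SAnd (dual p) (dual q)
  | SEx x p => SAll x (dual p)
  | SAll x p => SEx x (dual p)
  | SExF f m p => SAllF f m (dual p)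
  | SAllF f m p => SExF f m (dual p)
  end.

Definition alls (xs : seq nat) (p : sform) : sform := foldr (@SAll sym ar) p xs.

(** Numerical terms contain no constants; 0 is characterised as the only additive idempotent. *)
Definition is_zero (t : sterm) : sform := SEqT ar (TAdd t t) t.

Definition nonneg (t : sterm) (j : nat) : sform :=
  SExF j 0 (SEqT ar (TMul (TApp j [::]) (TApp j [::])) t).

(** Among the reals, 1 is the only nonzero multiplicative idempotent. *)
Definition is_one (o : sterm) : sform :=
  SAnd (SEqT ar (TMul o o) o) (SNeqT ar (TAdd o o) o).

(* A binary function [L] codes the relation [L(x,y) <> 0]. *)
Definition less (L x y : nat) : sform :=
  SNeqT ar (TAdd (TApp L [:: x; y]) (TApp L [:: x; y])) (TApp L [:: x; y]).
Definition not_less (L x y : nat) : sform := is_zero (TApp L [:: x; y]).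

Definition linear_order (L : nat) : sform :=
  SAnd (SAll 0 (not_less L 0 0))
  (SAnd (SAll 0 (SAll 1 (SAll 2
           (SOr (not_less L 0 1) (SOr (not_less L 1 2) (less L 0 2))))))
        (SAll 0 (SAll 1 (SOr (SEqV ar 0 1) (SOr (less L 0 1) (less L 1 0)))))).

(* Variables 0, 1, 2 and function symbols from [j] on are reserved for internal use. *)
Definition sum_is (x : nat) (t u : sterm) (j : nat) : sform :=
  let c y := TApp j.+1 [:: y] in
  SExF j 2 (SExF j.+1 1 (SAnd (linear_order j)
   (SAnd (SAll x (SOr (SEx 0 (less j 0 x)) (SEqT ar (c x) t)))
   (SAnd (SAll x (SAll 0 (SOr (not_less j 0 x)
            (SOr (SEx 1 (SAnd (less j 0 1) (less j 1 x)))
                 (SEqT ar (c x) (TAdd (c 0%N) t))))))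
         (SAll x (SOr (SEx 0 (less j x 0)) (SEqT ar (c x) u))))))).

(** The guessed function [j] stores, for each value of the first variable, the sum over the
    remaining ones. The functions for the inner sums are guessed after that value is fixed, so they
    need not take it as an argument. *)
Fixpoint sums_is (xs : seq nat) (t u : sterm) (j : nat) : sform :=
  match xs with
  | [::] => SEqT ar t u
  | x :: xs => SExF j 1 (SAnd (SAll x (sums_is xs t (TApp j [:: x]) j.+1))
                              (sum_is x (TApp j [:: x]) u j.+1))
  end.

(** Here and in [neqs], the atoms on the pair 0, 0 serve as truth and falsity. *)
Definition eqs (xs ys : seq nat) : sform :=
  foldr (fun p => SAnd (SEqV ar p.1 p.2)) (SEqV ar 0 0) (zip xs ys).
Definition neqs (xs ys : seq nat) : sform :=
  foldr (fun p => SOr (SNeqV ar p.1 p.2)) (SNeqV ar 0 0) (zip xs ys).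

Lemma is_ESO_alls xs p : is_ESO (alls xs p) = is_ESO p.
Proof. by elim: xs. Qed.

Lemma is_ESO_sums_is xs t u j : is_ESO (sums_is xs t u j).
Proof. by elim: xs u j => //= x xs IH u j; rewrite IH. Qed.

Lemma is_ESO_eqs xs ys : is_ESO (eqs xs ys).
Proof. by rewrite /eqs; elim: (zip xs ys). Qed.

Lemma is_ESO_neqs xs ys : is_ESO (neqs xs ys).
Proof. by rewrite /neqs; elim: (zip xs ys). Qed.

(** * Semantics of the building blocks *)

Section Semantics.
Variable A : structure ar.
Local Notation T := (dom A).
Implicit Types (s : nat -> T) (rho : fenv A) (p q : sform).

Lemma ssat_dual s rho p : ssat s rho (dual p) <-> ~ ssat s rho p.
Proof.
elim: p s rho => /=
  [t u|t u|x y|x y|r xs|r xs|p IHp q IHq|p IHp q IHq|x p IH|x p IH|f m p IH|f m p IH] s rho.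
- by [].
- by split=> [->|/contrapT]; [apply|].
- by [].
- by split=> [->|/contrapT]; [apply|].
- by split=> /negP.
- by split=> [->//|/negP]; rewrite negbK.
- by rewrite IHp IHq -not_andP.
- by rewrite IHp IHq -not_orP.
- split=> [H [a]|H a]; first by apply/IH.
  by apply/IH=> Ha; apply: H; exists a.
- split=> [[a /IH Ha] H|]; first by apply: Ha.
  by apply: contra_notP => H a; apply: contrapT => /IH Ha; apply: H; exists a.
- split=> [H [a]|H a]; first by apply/IH.
  by apply/IH=> Ha; apply: H; exists a.
- split=> [[a /IH Ha] H|]; first by apply: Ha.
  by apply: contra_notP => H a; apply: contrapT => /IH Ha; apply: H; exists a.
Qed.

Lemma supd_same s x a : supd s x a x = a.
Proof. by rewrite /supd eqxx. Qed.

Lemma supd_other s x a y : y != x -> supd s x a y = s y.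
Proof. by rewrite /supd => /negbTE->. Qed.

Lemma fupd_same rho f v : fupd rho f v f = v.
Proof. by rewrite /fupd eqxx. Qed.

Lemma fupd_other rho f v g : g != f -> fupd rho f v g = rho g.
Proof. by rewrite /fupd => /negbTE->. Qed.

(** Describing the block by agreement off [xs] avoids reasoning about nested updates. *)
Lemma ssat_alls s rho xs p :
  ssat s rho (alls xs p) <->
  forall s', (forall x, x \notin xs -> s' x = s x) -> ssat s' rho p.
Proof.
elim: xs s => [|x xs IH] s /=.
  split=> [H s' E|]; last exact.
  by have -> : s' = s by apply: funext => x; exact: E.
split=> [H s' E|H a].
  apply: (proj1 (IH _) (H (s' x))) => y yxs; rewrite /supd.
  by case: eqP => [->//|/eqP yx]; apply: E; rewrite inE negb_or yx.
apply/IH=> s' E; apply: H => y; rewrite inE negb_or => /andP[yx yxs].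
by rewrite E // supd_other.
Qed.

Lemma teval_eq s s' rho rho' t :
  (forall x, tvar t x -> s x = s' x) -> (forall f, tfun t f -> rho f = rho' f) ->
  teval s rho t = teval s' rho' t.
Proof.
elim: t => [f xs|t IHt u IHu|t IHt u IHu|t IHt] /= Ex Ef.
- rewrite Ef //; case: ifP => // _; congr (_ _).
  by apply/eq_in_map => x; exact: Ex.
- congr (_ + _); [apply: IHt|apply: IHu] => v Hv.
  + by apply: Ex; rewrite Hv.
  + by apply: Ef; rewrite Hv.
  + by apply: Ex; rewrite Hv orbT.
  + by apply: Ef; rewrite Hv orbT.
- congr (_ * _); [apply: IHt|apply: IHu] => v Hv.
  + by apply: Ex; rewrite Hv.
  + by apply: Ef; rewrite Hv.
  + by apply: Ex; rewrite Hv orbT.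
  + by apply: Ef; rewrite Hv orbT.
- by rewrite (IHt Ex Ef).
Qed.

Lemma addrr_eq (x : R) : (x + x = x) <-> (x = 0).
Proof. by split=> H; lra. Qed.

Lemma ssat_is_zero s rho t : ssat s rho (is_zero t) <-> teval s rho t = 0.
Proof. exact: addrr_eq. Qed.

Lemma ssat_is_one s rho t : ssat s rho (is_one t) <-> teval s rho t = 1.
Proof.
rewrite /= RplusE RmultE; move: (teval s rho t) => o; split=> [[H1 H2]|->]; last first.
  by rewrite mulr1; split=> // /addrr_eq/eqP; rewrite oner_eq0.
have : o * (o - 1) = 0 by rewrite mulrBr mulr1 H1 subrr.
move/eqP; rewrite mulf_eq0 => /orP[/eqP o0|/eqP]; last exact: subr0_eq.
by case: H2; rewrite o0 addr0.
Qed.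

Lemma ssat_nonneg s rho t j :
  ~~ tfun t j -> ssat s rho (nonneg t j) <-> 0 <= teval s rho t.
Proof.
move=> tj.
have E g : teval s (fupd rho j (0%N, g)) t = teval s rho t.
  by apply: teval_eq => // f tf; rewrite fupd_other //; apply: contraNneq tj => <-.
rewrite /= ; split=> [[g]|H].
  by rewrite E => <-; rewrite fupd_same /= RmultE -expr2 sqr_ge0.
exists (fun _ => Num.sqrt (teval s rho t)).
by rewrite E fupd_same /= RmultE -expr2 sqr_sqrtr.
Qed.

Lemma ssat_eqs s rho xs ys : size xs = size ys ->
  ssat s rho (eqs xs ys) <-> map s xs = map s ys.
Proof.
rewrite /eqs; elim: xs ys => [|x xs IH] [|y ys] //= [/IH->].
by split=> [[-> ->]|[-> ->]].
Qed.

Lemma ssat_neqs s rho xs ys : size xs = size ys ->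
  ssat s rho (neqs xs ys) <-> map s xs <> map s ys.
Proof.
rewrite /neqs; elim: xs ys => [|x xs IH] [|y ys] //= [/IH E]; rewrite /= E.
split=> [[H [/H]|H [_ /H]]//|H].
have [xy|] := eqVneq (s x) (s y); last by move/eqP; left.
by right=> xys; apply: H; rewrite xy xys.
Qed.

Definition lt_of (l : seq T -> R) : rel T := fun x y => l [:: x; y] != 0.

Lemma ssat_less s rho L l x y : rho L = (2%N, l) ->
  ssat s rho (less L x y) <-> lt_of l (s x) (s y).
Proof.
by move=> E; rewrite /= E /= addrr_eq /lt_of; split=> /eqP.
Qed.

Lemma ssat_not_less s rho L l x y : rho L = (2%N, l) ->
  ssat s rho (not_less L x y) <-> ~~ lt_of l (s x) (s y).
Proof.
by move=> E; rewrite /= E /= addrr_eq /lt_of negbK; split=> /eqP.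
Qed.

Lemma ssat_linear_order s rho L l : rho L = (2%N, l) ->
  ssat s rho (linear_order L) <->
  [/\ irreflexive (lt_of l), transitive (lt_of l) &
      forall x y, [\/ x = y, lt_of l x y | lt_of l y x]].
Proof.
move=> E; rewrite /linear_order /ssat -!/(ssat _ _ _).
split=> [[H1 [H2 H3]]|[H1 H2 H3]].
  split=> [x|y x z xy yz|x y].
  - by apply/negbTE; move: (H1 x) => /(ssat_not_less _ _ _ E).
  - case: (H2 x y z) => [/(ssat_not_less _ _ _ E)|
      [/(ssat_not_less _ _ _ E)|/(ssat_less _ _ _ E)]] //.
      by rewrite /supd /= xy.
    by rewrite /supd /= yz.
  - case: (H3 x y) => [|[/(ssat_less _ _ _ E)|/(ssat_less _ _ _ E)]] H;
      by [constructor 1|constructor 2|constructor 3].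
split; [|split].
- by move=> x; apply/(ssat_not_less _ _ _ E); rewrite H1.
- move=> x y z; case xy: (lt_of l x y); last first.
    by left; apply/(ssat_not_less _ _ _ E); rewrite /supd /= xy.
  case yz: (lt_of l y z); right; last first.
    by left; apply/(ssat_not_less _ _ _ E); rewrite /supd /= yz.
  by right; apply/(ssat_less _ _ _ E); apply: H2 yz.
- move=> x y; case: (H3 x y) => H; first by left.
    by right; left; apply/(ssat_less _ _ _ E).
  by right; right; apply/(ssat_less _ _ _ E).
Qed.

(** From left to right, uniqueness of running sums forces the guessed function, whose value at the
    last element is the full sum. From right to left, an enumeration of the universe supplies the
    order. The bounds on variables and symbols prevent capture by the internal quantifiers; [x] may
    still be 2. *)
Lemma ssat_sum_is s rho x t u j :
  (1 < x)%N -> (forall y, tvar t y -> (1 < y)%N) ->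
  (forall y, tvar u y -> (1 < y)%N && (y != x)) ->
  (forall f, tfun t f || tfun u f -> (f < j)%N) ->
  ssat s rho (sum_is x t u j) <->
  \sum_(a : T) teval (supd s x a) rho t = teval s rho u.
Proof.
move=> x1 tv uv tuf.
have x0 : (x == 0)%N = false by case: x x1 {uv}.
have x0' : (0 == x)%N = false by rewrite eq_sym.
have x1' : (1 == x)%N = false by rewrite eqn_leq [(x <= _)%N]leqNgt x1 andbF.
have x2' : (x == 1)%N = false by rewrite eq_sym.
have jj : (j == j.+1) = false by rewrite eqn_leq ltnn andbF.
pose h a := teval (supd s x a) rho t.
set v := teval s rho u.
rewrite -[X in _ <-> X]/(\sum_a h a = v).
have core l c (r := fupd (fupd rho j (2%N, l)) j.+1 (1%N, c)) :
   ssat s r (linear_order j) -> 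
   [/\ irreflexive (lt_of l), transitive (lt_of l) &
      forall x y, [\/ x = y, lt_of l x y | lt_of l y x]].
  by move/(@ssat_linear_order _ _ _ l); apply; rewrite /r /fupd jj eqxx.
(* Neither the two guessed functions nor the auxiliary variable 0 affects the value of [t], and [u]
   is constant in [x]. *)
have Er l c (r := fupd (fupd rho j (2%N, l)) j.+1 (1%N, c)) :
  [/\ r j = (2%N, l), r j.+1 = (1%N, c),
      forall a, teval (supd s x a) r t = h a, 
      forall a b, teval (supd (supd s x a) 0 b) r t = h a &
      forall a, teval (supd s x a) r u = v].
  have rf f : tfun t f || tfun u f -> r f = rho f.
    move=> /tuf fj; rewrite /r /fupd; case: eqP => [E|_].
      by rewrite E ltnNge leqnSn in fj.
    by case: eqP => // E; rewrite E ltnn in fj.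
  split=> [|||a b|a]; rewrite /r /fupd ?eqxx ?jj //.
  - by move=> a; apply: teval_eq => // f tf; apply: rf; rewrite tf.
  - apply: teval_eq => [y /tv|f tf]; last by apply: rf; rewrite tf.
    by rewrite {1}/supd; case: eqP => [->|].
  - apply: teval_eq => [y /uv/andP[_ yx]|f tf]; last by apply: rf; rewrite tf orbT.
    by rewrite supd_other.
(* The three clauses on running sums become statements about [l] and [c]; the first two are exactly
   the hypotheses of [running_sum_unique]. *)
have gen l c (r := fupd (fupd rho j (2%N, l)) j.+1 (1%N, c)) :
  [/\ (ssat s r (SAll x (SOr (SEx 0 (less j 0 x)) (SEqT ar (TApp j.+1 [:: x]) t))) <->
        forall a, (exists w, lt_of l w a) \/ c [:: a] = h a),
     (ssat s r (SAll x (SAll 0 (SOr (not_less j 0 x)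
            (SOr (SEx 1 (SAnd (less j 0 1) (less j 1 x)))
                 (SEqT ar (TApp j.+1 [:: x]) (TAdd (TApp j.+1 [:: 0%N]) t)))))) <->
        forall a b, [\/ ~~ lt_of l b a, exists w, lt_of l b w && lt_of l w a |
                        c [:: a] = c [:: b] + h a]) &
     (ssat s r (SAll x (SOr (SEx 0 (less j x 0)) (SEqT ar (TApp j.+1 [:: x]) u))) <->
        forall a, (exists w, lt_of l a w) \/ c [:: a] = v)].
  move: (Er l c); rewrite -/r => -[rj rj1 Et Et0 Eu]; clearbody r.
  have c1 s' y : teval s' r (TApp j.+1 [:: y]) = c [:: s' y] by rewrite /= rj1.
  have L0 a w : ssat (supd (supd s x a) 0 w) r (less j 0 x) <-> lt_of l w a.
    by rewrite (ssat_less _ _ _ rj) /supd /= x0 eqxx.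
  have L1 a b w : ssat (supd (supd (supd s x a) 0 b) 1 w) r
      (SAnd (less j 0 1) (less j 1 x)) <-> lt_of l b w && lt_of l w a.
    split=> [[/(ssat_less _ _ _ rj) W1 /(ssat_less _ _ _ rj) W2]|/andP[W1 W2]].
      by move: W1 W2; rewrite /supd /= x0 x2' eqxx => -> ->.
    by split; apply/(ssat_less _ _ _ rj); rewrite /supd /= ?x0 ?x2' ?eqxx.
  have L2 a w : ssat (supd (supd s x a) 0 w) r (less j x 0) <-> lt_of l a w.
    by rewrite (ssat_less _ _ _ rj) /supd /= x0 eqxx.
  have N0 a w : ssat (supd (supd s x a) 0 w) r (not_less j 0 x) <-> ~~ lt_of l w a.
    by rewrite (ssat_not_less _ _ _ rj) /supd /= x0 eqxx.
  have E1 a : ssat (supd s x a) r (SEqT ar (TApp j.+1 [:: x]) t) <-> c [:: a] = h a.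
    by rewrite -[ssat _ _ _]/(teval _ _ _ = teval _ _ _) Et c1 supd_same.
  have E2 a b : ssat (supd (supd s x a) 0 b) r
      (SEqT ar (TApp j.+1 [:: x]) (TAdd (TApp j.+1 [:: 0%N]) t)) <->
      c [:: a] = c [:: b] + h a.
    change (teval (supd (supd s x a) 0 b) r (TApp j.+1 [:: x]) =
      Rdefinitions.Rplus (teval (supd (supd s x a) 0 b) r (TApp j.+1 [:: 0%N]))
        (teval (supd (supd s x a) 0 b) r t) <-> c [:: a] = c [:: b] + h a).
    by rewrite RplusE Et0 !c1 /supd /= x0 eqxx.
  have E3 a : ssat (supd s x a) r (SEqT ar (TApp j.+1 [:: x]) u) <-> c [:: a] = v.
    by rewrite -[ssat _ _ _]/(teval _ _ _ = teval _ _ _) Eu c1 supd_same.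
  split.
  - by split=> H a; (case: (H a) => [[w /L0]|/E1]; [left; exists w|right]).
  - split=> H a b.
      case: (H a b) => [/N0|[[w /L1]|/E2]];
        [by constructor 1|by constructor 2; exists w|by constructor 3].
    case: (H a b) => [/N0|[w /L1]|/E2];
      [by left|by right; left; exists w|by right; right].
  - by split=> H a; (case: (H a) => [[w /L2]|/E3]; [left; exists w|right]).
split=> [[l [c [O [H1 [H2 H3]]]]]|H].
  have [G1 G2 G3] := gen l c.
  move: O => /core[lt_irr lt_tr lt_tot].
  (* The environment itself provides an element of the universe, so a last element exists. *)
  have [z zl] := exists_last lt_irr lt_tr (s 0%N).
  have E := running_sum_unique lt_irr lt_tr lt_tot (proj1 G1 H1) (proj1 G2 H2) z.
  rewrite -(running_sum_last lt_tot h zl) -E.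
  by case: (proj1 G3 H3 z) => // -[w]; rewrite (negbTE (zl w)).
(* Witnesses for the converse: the order of the enumeration, coded by its indicator function, and
   its true running sums. *)
pose rk (a b : T) := (enum_rank a < enum_rank b)%N.
pose l (q : seq T) : R := if q is [:: a; b] then (rk a b)%:R else 0.
have lE : lt_of l = rk.
  by apply: funext => a; apply: funext => b; rewrite /lt_of /= pnatr_eq0 eqb0 negbK.
have rk_irr : irreflexive rk by move=> a; exact: ltnn.
have rk_tr : transitive rk by move=> b a d; exact: ltn_trans.
have rk_tot a b : [\/ a = b, rk a b | rk b a].
  case: (ltngtP (enum_rank a) (enum_rank b)) => E;
    [constructor 2|constructor 3|constructor 1] => //.
  by apply: enum_rank_inj; apply: val_inj.
pose c (q : seq T) := if q is [:: a] then running_sum rk h a else 0.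
have [G1 G2 G3] := gen l c; exists l, c; split; last (split; last split).
- apply/(@ssat_linear_order _ _ _ l); first by rewrite /fupd jj eqxx.
  by rewrite lE.
- apply/G1 => a; rewrite lE /=; case: (pselect (exists w, rk w a)) => [|n]; [by left|right].
  by apply: running_sum_first => w; apply/negP=> W; apply: n; exists w.
- apply/G2 => a b; rewrite lE /=; case ba: (rk b a); [|by constructor 1].
  case: (pselect (exists w, rk b w && rk w a)) => [|n]; [by constructor 2|constructor 3].
  by apply: running_sum_succ => // w; apply/negP=> W; apply: n; exists w.
- apply/G3 => a; rewrite lE /=; case: (pselect (exists w, rk a w)) => [|n]; [by left|right].
  rewrite -H; apply: running_sum_last => // w; apply/negP=> W; apply: n; exists w => //.
Qed.

Fixpoint iter_sum (xs : seq nat) (h : (nat -> T) -> R) (s : nat -> T) : R :=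
  if xs is x :: xs then \sum_(a : T) iter_sum xs h (supd s x a) else h s.

Lemma ssat_sums_is s rho xs t u j :
  uniq xs -> all (ltn 1) xs -> (forall y, tvar t y -> (1 < y)%N) ->
  (forall y, tvar u y -> (1 < y)%N && (y \notin xs)) ->
  (forall f, tfun t f || tfun u f -> (f < j)%N) ->
  ssat s rho (sums_is xs t u j) <->
  iter_sum xs (fun s => teval s rho t) s = teval s rho u.
Proof.
elim: xs s rho u j => [|x xs IH] s rho u j //= /andP[xxs uxs] /andP[x1 xs1] tv uv tuf.
have tj g f : tfun t f || tfun u f -> fupd rho j (1%N, g) f = rho f.
  by move=> /tuf fj; rewrite fupd_other //; apply/eqP=> E; rewrite E ltnn in fj.
have key g a : ssat (supd s x a) (fupd rho j (1%N, g)) (sums_is xs t (TApp j [:: x]) j.+1) <->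
    iter_sum xs (fun s => teval s rho t) (supd s x a) = g [:: a].
  rewrite IH //=; last 2 first.
  - by move=> y; rewrite inE => /eqP->; rewrite x1.
  - by move=> f /orP[tf|/eqP<-//]; rewrite ltnW // ltnS tuf ?tf.
  rewrite fupd_same /= supd_same.
  rewrite (_ : (fun s0 => _) = (fun s => teval s rho t)) //.
  by apply: funext => s'; apply: teval_eq => // f tf; rewrite tj ?tf.
have key2 g : ssat s (fupd rho j (1%N, g)) (sum_is x (TApp j [:: x]) u j.+1) <->
    \sum_a g [:: a] = teval s rho u.
  rewrite ssat_sum_is //=; last 3 first.
  - by move=> y; rewrite inE => /eqP->.
  - by move=> y /uv; rewrite inE negb_or => /and3P[-> ->].
  - by move=> f /orP[/eqP<-//|tf]; rewrite ltnW // ltnS tuf ?tf ?orbT.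
  rewrite fupd_same /= (@teval_eq s s _ rho) => // [|f tf]; last by rewrite tj ?tf ?orbT.
  rewrite (eq_bigr (fun a => g [:: a])) // => a _; by rewrite supd_same.
split=> [[g [H1 /key2<-]]|H].
  by apply: eq_bigr => a _; apply/key.
exists (fun q : seq T =>
  if q is [:: a] then iter_sum xs (fun s => teval s rho t) (supd s x a) else 0).
by split; [move=> a; apply/key|apply/key2].
Qed.

End Semantics.
End Formulas.

(** * Teams as functions *)

Section Teams.
Variables (sym : Type) (ar : sym -> nat) (N : nat).

(* Shifted by 3, since the first-order variables 0, 1, 2 are reserved. *)
Definition fo_var (i : 'I_N) : nat := i.+3.
Local Notation fo_vars := (map fo_var).

Lemma fo_var_inj : injective fo_var.
Proof. by move=> i j [/val_inj]. Qed.

Lemma mem_fo_vars i vs : (fo_var i \in fo_vars vs) = (i \in vs).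
Proof. exact: (mem_map fo_var_inj). Qed.

Lemma fo_vars_gt1 vs : all (ltn 1) (fo_vars vs).
Proof. by apply/allP=> _ /mapP[i _ ->]. Qed.

Definition team_app (f : nat) (vs : seq 'I_N) : sterm := TApp f (fo_vars vs).

Lemma tvar_team_app f vs y : tvar (team_app f vs) y -> (1 < y)%N.
Proof. by move=> /(allP (fo_vars_gt1 _)). Qed.

(** The total mass is compared with a guessed nullary function that is forced to equal 1. *)
Definition is_team_form (vs : seq 'I_N) (f j : nat) : sform ar :=
  SAnd (alls (fo_vars vs) (nonneg ar (team_app f vs) j))
       (SExF j 0 (SAnd (is_one ar (TApp j [::]))
                       (sums_is ar (fo_vars vs) (team_app f vs) (TApp j [::]) j.+1))).

(** Requantifying a variable leaves the list unchanged, so that it stays free of duplicates. *)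
Definition add_var (x : 'I_N) (vs : seq 'I_N) := if x \in vs then vs else x :: vs.

Lemma mem_add_var x vs i : (i \in add_var x vs) = (i == x) || (i \in vs).
Proof. by rewrite /add_var; case: ifP => // xvs; case: eqP => [->|]. Qed.

Lemma uniq_add_var x vs : uniq vs -> uniq (add_var x vs).
Proof. by rewrite /add_var; case: ifP => //= ->. Qed.

Lemma set_add_var x vs : [set i in add_var x vs] = x |: [set i in vs].
Proof. by apply/setP=> i; rewrite !inE mem_add_var. Qed.

(* [u] is the weight of the assignments that agree with the current one off [x]. *)
Definition forget_eq (x : 'I_N) (vs : seq 'I_N) (f : nat) (u : sterm) (j : nat) : sform ar :=
  if x \in vs then sum_is ar (fo_var x) (team_app f vs) u j
  else SEqT ar (team_app f vs) u.

(** * Assignments against environments, and teams against functions *)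

Section Semantics.
Variable A : structure ar.
Local Notation T := (dom A).
Local Notation asg := (asg N A).
Implicit Types (s : nat -> T) (rho : fenv A) (X : asg -> R) (vs : seq 'I_N) (u : asg).

Definition asg_env vs s : asg :=
  [ffun i => if i \in vs then Some (s (fo_var i)) else None].

Definition has_dom vs u := [forall i, (u i != None) == (i \in vs)].

Definition supported vs X := forall u, X u != 0 -> has_dom vs u.

(** Only arguments listing the values of [vs] are constrained, which is all that [team_app]
    reads. *)
Definition encodes rho f vs X :=
  (rho f).1 = size vs /\ forall s, (rho f).2 (map s (fo_vars vs)) = X (asg_env vs s).

Lemma has_dom_asg_env vs s : has_dom vs (asg_env vs s).
Proof. by apply/forallP=> i; rewrite ffunE; case: ifP. Qed.

Lemma eq_asg_env vs s s' :
  {in vs, forall i, s (fo_var i) = s' (fo_var i)} -> asg_env vs s = asg_env vs s'.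
Proof. by move=> E; apply/ffunP=> i; rewrite !ffunE; case: ifP => // /E->. Qed.

Lemma asg_of_map vs s : asg_of vs (map s (fo_vars vs)) = asg_env vs s.
Proof.
apply/ffunP=> i; rewrite !ffunE; case: ifP => // ivs.
rewrite -!map_comp (nth_map i) ?index_mem //=; by rewrite nth_index.
Qed.

Lemma has_domP (s0 : nat -> T) vs u : has_dom vs u -> exists s, u = asg_env vs s.
Proof.
move=> /forallP du.
(* Subtracting 3 undoes the shift of [fo_var]. The values at 0, 1, 2 are arbitrary, as [asg_env]
   never reads them. *)
exists (fun n => if insub (n - 3)%N is Some i then odflt (s0 0%N) (u i) else s0 0%N).
apply/ffunP=> i; rewrite ffunE /fo_var -[i.+3]addn3 addnK valK.
by move: (eqP (du i)); case: (u i) => [a|] <-.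
Qed.

Lemma supported_eq0 vs X u : supported vs X -> ~~ has_dom vs u -> X u = 0.
Proof. by move=> sX; apply: contraNeq => /sX. Qed.

Lemma is_team_supported vs X : is_team [set i in vs] X -> supported vs X.
Proof.
by case=> _ _ H u /H E; apply/forallP=> i; rewrite E inE.
Qed.

Lemma is_teamP vs X : is_team [set i in vs] X <->
  [/\ forall u, 0 <= X u, \sum_u X u = 1 & supported vs X].
Proof.
split=> [H|[H1 H2 H3]]; first by have := is_team_supported H; case: H.
by split=> // u /H3/forallP H i; rewrite inE (eqP (H i)).
Qed.

Lemma encodes_fupd rho f g v vs X :
  f != g -> encodes rho f vs X -> encodes (fupd rho g v) f vs X.
Proof. by move=> fg; rewrite /encodes fupd_other. Qed.

Lemma teval_team_app s rho f vs X :
  encodes rho f vs X -> teval s rho (team_app f vs) = X (asg_env vs s).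
Proof. by case=> E1 E2; rewrite /= size_map E1 eqxx. Qed.

(** The meaning of [p] needs to be known only in environments that agree with [s] off the team
    variables; this lets [p] mention further variables that are held fixed. *)
Lemma ssat_alls_team s rho vs p (P : asg -> Prop) :
  (forall s', (forall x, x \notin fo_vars vs -> s' x = s x) ->
     ssat s' rho p <-> P (asg_env vs s')) ->
  ssat s rho (alls (fo_vars vs) p) <-> forall s', P (asg_env vs s').
Proof.
move=> H; rewrite ssat_alls; split=> [H1 s'|H1 s' E]; last exact/H.
(* Splicing [s'] on the team variables into [s] gives the same assignment and falls within the range
   of the block. *)
pose s'' x := if x \in fo_vars vs then s' x else s x.
have E x : x \notin fo_vars vs -> s'' x = s x by rewrite /s'' => /negbTE->.
rewrite (@eq_asg_env _ s' s'') => [|i ivs]; first by apply/H => //; apply: H1.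
by rewrite /s'' mem_fo_vars ivs.
Qed.

(** Formulas only see assignments with domain [vs]. Elsewhere supported weights vanish, which
    settles the remaining cases in the applications. *)
Lemma forall_supported (s0 : nat -> T) vs (P : asg -> Prop) :
  (forall u, ~~ has_dom vs u -> P u) ->
  (forall s, P (asg_env vs s)) <-> (forall u, P u).
Proof.
move=> H; split=> H1 u; last exact: H1.
by case du: (has_dom vs u); [case: (has_domP s0 du) => s ->|apply: H; rewrite du].
Qed.

(** Up to irrelevant arguments, functions on tuples and weights supported on domain [vs] are two
    codings of the same data. Function quantifiers thus range over real weights of any sign; being a
    team is imposed separately. *)
Lemma ssat_ex_team s rho f vs p (Q : (asg -> R) -> Prop) :
  uniq vs ->
  (forall v X, supported vs X -> encodes (fupd rho f v) f vs X ->
     ssat s (fupd rho f v) p <-> Q X) ->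
  ssat s rho (SExF f (size vs) p) <-> exists X, supported vs X /\ Q X.
Proof.
move=> uvs H; split=> [[g Hg]|[X [sX QX]]].
  (* For [u] with domain [vs], [pmap u vs] drops no entry and lists the values of [u] on [vs]. *)
  pose X u := if has_dom vs u then g (pmap u vs) else 0.
  have sX : supported vs X by move=> u; rewrite /X; case: ifP => // _; rewrite eqxx.
  exists X; split=> //; apply/(H (size vs, g)) => //.
  split=> [|s']; rewrite fupd_same //= /X has_dom_asg_env; congr g.
  have E: {in vs, forall i, asg_env vs s' i = Some (s' (fo_var i))}.
    by move=> i ivs; rewrite ffunE ivs.
  move: (asg_env vs s') E => u; elim: (vs) => //= i ws IH E.
  by rewrite E ?mem_head //= -IH // => k kws; rewrite E // inE kws orbT.
exists (fun a => X (asg_of vs a)); apply/(H _ X) => //.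
by split=> [|s']; rewrite fupd_same //= asg_of_map.
Qed.

Fixpoint supds s (xs : seq nat) (a : seq T) : nat -> T :=
  if xs is x :: xs then if a is b :: a then supds (supd s x b) xs a else s else s.

Lemma supds_other s xs a y : y \notin xs -> supds s xs a y = s y.
Proof.
elim: xs s a => //= x xs IH s [|b a] //; rewrite inE negb_or => /andP[yx yxs].
by rewrite IH // supd_other.
Qed.

Lemma map_supds s xs a : uniq xs -> size a = size xs -> map (supds s xs a) xs = a.
Proof.
elim: xs s a => [|x xs IH] s [|b a] //= /andP[xxs uxs] [sa].
by rewrite IH // supds_other // supd_same.
Qed.

Lemma iter_sum_tuple n xs h s : size xs = n ->
  iter_sum xs h s = \sum_(a : n.-tuple T) h (supds s xs a).
Proof.
move=> <-{n}; elim: xs s => [|x xs IH] s /=.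
  rewrite (bigD1 [tuple]) //= big1 ?addr0 // => a /negP[].
  by apply/eqP; exact: tuple0.
rewrite (sum_tuple_cons _ (fun a => h (if a is b :: a then supds (supd s x b) xs a else s))) /=.
by apply: eq_bigr => b _; rewrite IH.
Qed.

(** Assignments with domain [vs] correspond bijectively to tuples of values, through [enc] and
    [dec], because [vs] has no repetitions. *)
Lemma sum_supported s vs X : uniq vs -> supported vs X ->
  \sum_u X u = iter_sum (fo_vars vs) (fun s => X (asg_env vs s)) s.
Proof.
move=> uvs sX; rewrite (@iter_sum_tuple (size vs)) ?size_map //.
have ufv : uniq (fo_vars vs) by rewrite (map_inj_uniq fo_var_inj).
transitivity (\sum_(u | has_dom vs u) X u).
  rewrite [RHS]big_mkcond; apply: eq_bigr => u _; case: ifP => // du.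
  by apply: (supported_eq0 sX); rewrite du.
pose dec u : (size vs).-tuple T := [tuple of map (fun i => odflt (s 0%N) (u i)) (in_tuple vs)].
pose enc (a : (size vs).-tuple T) := asg_env vs (supds s (fo_vars vs) a).
have decE s' : dec (asg_env vs s') = map s' (fo_vars vs) :> seq T.
  by rewrite -map_comp; apply/eq_in_map => i ivs; rewrite /= ffunE ivs.
rewrite (reindex_onto enc dec) /=; last first.
  move=> u /(has_domP s)[s' ->]; rewrite /enc -asg_of_map map_supds //.
    by rewrite decE asg_of_map.
  by rewrite size_tuple size_map.
apply: eq_bigl => a; rewrite has_dom_asg_env; apply/eqP/val_inj.
by rewrite /= decE map_supds // size_tuple size_map.
Qed.

Lemma ssat_is_team s rho vs f j X :
  uniq vs -> (f < j)%N -> supported vs X -> encodes rho f vs X ->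
  ssat s rho (is_team_form vs f j) <-> is_team [set i in vs] X.
Proof.
move=> uvs fj sX eX; have fj' : f != j by rewrite ltn_eqF.
rewrite is_teamP.
have H1 : ssat s rho (alls (fo_vars vs) (nonneg ar (team_app f vs) j)) <->
    forall u, 0 <= X u.
  rewrite -(forall_supported s (vs := vs)) => [|u /(supported_eq0 sX)->//].
  apply: (@ssat_alls_team _ _ _ _ (fun u => 0 <= X u)) => s' _.
  by rewrite ssat_nonneg ?(teval_team_app _ eX) // eq_sym.
have H2 g : ssat s (fupd rho j (0%N, g))
    (sums_is ar (fo_vars vs) (team_app f vs) (TApp j [::]) j.+1) <->
    \sum_u X u = g [::].
  rewrite ssat_sums_is ?(map_inj_uniq fo_var_inj) ?fo_vars_gt1 //; last 2 first.
  - exact: tvar_team_app.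
  - by move=> h /orP[/eqP<-|/eqP<-//]; rewrite ltnW.
  rewrite /= fupd_same /= (sum_supported s uvs sX).
  rewrite (_ : (fun s0 => _) = (fun s0 => X (asg_env vs s0))) //.
  by apply: funext => s0; apply/teval_team_app/encodes_fupd.
have H3 g : ssat s (fupd rho j (0%N, g)) (is_one ar (TApp j [::])) <-> g [::] = 1.
  by rewrite ssat_is_one /= fupd_same.
split=> [[/H1 h1 [g [/H3 h3 /H2 h2]]]|[/H1 h1 h2 _]]; first by split=> //; rewrite h2.
by split=> //; exists (fun _ => 1); split; [apply/H3|apply/H2].
Qed.

(** * Extending a team by a variable *)

Lemma upd_asg_env vs s x a :
  upd (asg_env vs s) x a = asg_env (add_var x vs) (supd s (fo_var x) a).
Proof.
apply/ffunP=> i; rewrite !ffunE mem_add_var; case: eqP => [->|/eqP ix] /=.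
  by rewrite supd_same.
by rewrite supd_other ?(inj_eq fo_var_inj).
Qed.

Lemma asg_env_supd vs s x a :
  x \notin vs -> asg_env vs (supd s (fo_var x) a) = asg_env vs s.
Proof.
move=> xvs; apply: eq_asg_env => i ivs; rewrite supd_other // (inj_eq fo_var_inj).
by apply: contraNneq xvs => <-.
Qed.

(** The mass of the class of assignments agreeing off [x]. The class is a single assignment when [x]
    is new, whence the case split. *)
Definition forget x vs X s : R :=
  if x \in vs then \sum_(b : T) X (asg_env vs (supd s (fo_var x) b)) else X (asg_env vs s).

(** In the double sum defining [ext], only the value [a] that the target takes at [x] survives, and
    only assignments that agree with the target off [x]. *)
Lemma ext_asg_env vs X x F s : supported vs X ->
  ext X x F (asg_env (add_var x vs) s) =
  forget x vs (fun u => X u * F u (s (fo_var x))) s.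
Proof.
move=> sX; set a := s (fo_var x); set W := fun u : asg => _; set u := asg_env _ s.
have ux : u x = Some a by rewrite ffunE mem_add_var eqxx.
have -> : ext X x F u = \sum_(t | (u == upd t x a) && has_dom vs t) W t.
  rewrite [RHS]big_mkcond; apply: eq_bigr => t _; rewrite (bigD1 a) //= big1 ?addr0.
    case: eqP => //= _; case: ifP => // dt.
    by rewrite (@supported_eq0 vs X) ?dt // mul0r.
  move=> b ba; case: eqP => // E; move: ux; rewrite E ffunE eqxx => -[/eqP].
  by rewrite (negbTE ba).
rewrite /forget; case: ifPn => xvs.
  (* When [x] is an old variable, the contributing assignments are parametrised by the value at [x]
     that the extension overwrites. *)
  rewrite (reindex_onto (fun b => asg_env vs (supd s (fo_var x) b))
                        (fun t => odflt a (t x))) /=.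
    apply: eq_bigl => b; rewrite has_dom_asg_env ffunE xvs supd_same eqxx !andbT.
    rewrite upd_asg_env; apply/eqP/eq_asg_env => i _; rewrite /supd /a.
    by case: eqP => [->|].
  move=> t /andP[/eqP E /(has_domP s)[s' Et]]; rewrite Et; apply/ffunP=> i.
  rewrite !ffunE; case: ifP => // ivs; congr Some; rewrite xvs /= /supd.
  rewrite (inj_eq fo_var_inj); case: eqP => [->//|/eqP ix].
  move/ffunP/(_ i): E; rewrite !ffunE mem_add_var ivs orbT (negbTE ix) Et ffunE ivs.
  by case.
rewrite (bigD1 (asg_env vs s)) /=; last first.
  by rewrite has_dom_asg_env upd_asg_env andbT; apply/eqP/eq_asg_env => i _; rewrite /supd /a; case: eqP => [->|].
rewrite big1 ?addr0 // => t /andP[/andP[/eqP E /(has_domP s)[s' Et]] /eqP[]].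
rewrite Et; apply/ffunP=> i; move/ffunP/(_ i): E.
rewrite Et !ffunE mem_add_var; case: (boolP (i \in vs)) => // ivs; rewrite orbT.
by case: eqP => [E|//]; rewrite -E ivs in xvs.
Qed.

Lemma ext_supported vs X x F : supported vs X -> supported (add_var x vs) (ext X x F).
Proof.
move=> sX u; apply: contraNT => du; apply/eqP.
apply: big1 => t _; apply: big1 => a _; case: eqP => // E.
have [->|/sX/forallP dt] := eqVneq (X t) 0; first by rewrite mul0r.
case/negP: du; apply/forallP=> i; rewrite E ffunE mem_add_var.
by case: (i =P x) => //= _; exact: dt.
Qed.

Lemma ext_is_team vs X x F :
  is_team [set i in vs] X ->
  (forall u, (forall a, 0 <= F u a) /\ \sum_a F u a = 1) ->
  is_team [set i in add_var x vs] (ext X x F).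
Proof.
move=> /is_teamP[X0 X1 sX] wF; apply/is_teamP; split; last exact: ext_supported.
  move=> u; apply: sumr_ge0 => t _; apply: sumr_ge0 => a _; case: ifP => // _.
  by rewrite mulr_ge0 //; case: (wF t).
(* After swapping the sums, each pair of [t] and [a] contributes to exactly one assignment,
   [upd t x a]. *)
rewrite exchange_big -[RHS]X1; apply: eq_bigr => t _; rewrite exchange_big /=.
rewrite (eq_bigr (fun a => X t * F t a)) => [|a _].
  by rewrite -mulr_sumr (proj2 (wF t)) mulr1.
by rewrite -big_mkcond big_pred1_eq.
Qed.

Lemma forget_supd x vs X s a : forget x vs X (supd s (fo_var x) a) = forget x vs X s.
Proof.
rewrite /forget; case: ifPn => [_|xvs]; last by rewrite asg_env_supd.
apply: eq_bigr => b _; congr X; apply: eq_asg_env => i _.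
by rewrite /supd; case: eqP.
Qed.

Lemma ext_mass vs X x F s : supported vs X -> (forall u, \sum_a F u a = 1) ->
  \sum_a ext X x F (asg_env (add_var x vs) (supd s (fo_var x) a)) = forget x vs X s.
Proof.
move=> sX wF; under eq_bigr do rewrite (ext_asg_env _ _ _ sX) supd_same forget_supd.
rewrite /forget; case: ifP => _; last by rewrite -mulr_sumr wF mulr1.
by rewrite exchange_big /=; apply: eq_bigr => b _; rewrite -mulr_sumr wF mulr1.
Qed.

(* Conditional distributions; where the mass vanishes any distribution will do. *)
Lemma ext_of_mass (s0 : nat -> T) vs X x Y :
  supported vs X -> supported (add_var x vs) Y -> (forall u, 0 <= Y u) ->
  (forall s, \sum_a Y (asg_env (add_var x vs) (supd s (fo_var x) a)) = forget x vs X s) ->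
  exists2 F : asg -> T -> R,
    forall u, (forall a, 0 <= F u a) /\ \sum_a F u a = 1 & Y = ext X x F.
Proof.
move=> sX sY Y0 YX.
pose M u := \sum_a Y (upd u x a).
pose F u a := if M u == 0 then (#|T|%:R)^-1 else Y (upd u x a) / M u.
have M0 u : 0 <= M u by apply: sumr_ge0.
have T0 : #|T|%:R != 0 :> R.
  by rewrite pnatr_eq0 -lt0n; apply/card_gt0P; exists (s0 0%N).
exists F => [u|].
  rewrite /F; case: eqP => [_|/eqP Mu]; split.
  - by move=> a; rewrite invr_ge0 ler0n.
  - by rewrite sumr_const -[_ *+ _]mulr_natr mulVf.
  - by move=> a; rewrite mulr_ge0 ?invr_ge0.
  - by rewrite -mulr_suml divff.
have MY s : M (asg_env vs s) = forget x vs X s.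
  by rewrite -YX; apply: eq_bigr => a _; rewrite upd_asg_env.
(* [F] is constant on classes of assignments agreeing off [x], hence factors out of [forget]. *)
have FE s b a : F (asg_env vs (supd s (fo_var x) b)) a = F (asg_env vs s) a.
  have E c : upd (asg_env vs (supd s (fo_var x) b)) x c = upd (asg_env vs s) x c.
    by rewrite !upd_asg_env; apply: eq_asg_env => i _; rewrite /supd; case: eqP.
  by rewrite /F /M E; under eq_bigr do rewrite E.
apply: funext; apply/(forall_supported s0 (vs := add_var x vs)) => [u du|s].
  by rewrite (supported_eq0 sY) // (supported_eq0 (ext_supported sX)).
rewrite (ext_asg_env _ _ _ sX).
have -> : forget x vs (fun u => X u * F u (s (fo_var x))) s =
          forget x vs X s * F (asg_env vs s) (s (fo_var x)).
  rewrite /forget; case: ifP => // _; rewrite mulr_suml; apply: eq_bigr => b _.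
  by rewrite FE.
have Es : asg_env (add_var x vs) s = upd (asg_env vs s) x (s (fo_var x)).
  by rewrite upd_asg_env; apply: eq_asg_env => i _; rewrite /supd; case: eqP => [->|].
rewrite -MY /F -Es; case: eqP => [E|/eqP Mu]; last by rewrite mulrC divfK.
(* On a class of mass zero, nonnegativity forces every weight of [Y] to vanish. *)
rewrite E mul0r; apply/eqP; move/eqP: E.
by rewrite psumr_eq0 // => /allP/(_ (s (fo_var x))); rewrite mem_index_enum -Es; exact.
Qed.

Lemma ext_all_asg_env vs X x s : supported vs X ->
  ext_all X x (asg_env (add_var x vs) s) = forget x vs X s / #|T|%:R.
Proof.
move=> sX; rewrite /ext_all (ext_asg_env _ _ _ sX) /forget.
by case: ifP => // _; rewrite mulr_suml.
Qed.

Lemma ssat_forget_eq s rho x vs f g j X :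
  (f < j)%N -> (g < j)%N -> encodes rho f vs X ->
  ssat s rho (forget_eq x vs f (TApp g [::]) j) <->
  forget x vs X s = teval s rho (TApp g [::]).
Proof.
move=> fj gj eX; rewrite /forget_eq /forget; case: ifP => _; last first.
  change (teval s rho (team_app f vs) = teval s rho (TApp g [::]) <->
    X (asg_env vs s) = teval s rho (TApp g [::])).
  by rewrite (teval_team_app _ eX).
rewrite ssat_sum_is //; last 2 first.
- exact: tvar_team_app.
- by move=> h /orP[/eqP<-|/eqP<-].
by under eq_bigr do rewrite (teval_team_app _ eX).
Qed.

End Semantics.
End Teams.

(** * The translation *)

Lemma map_Some_inj (T : Type) : injective (map (@Some T)).
Proof. by apply: inj_map => a b []. Qed.

Section Translation.
Variables (sym : Type) (ar : sym -> nat) (N : nat).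
Local Notation fo_vars := (map (@fo_var N)).

(** A literal constrains the support only, so weight zero is an escape clause. *)
Definition literal_form (vs : seq 'I_N) (f : nat) (p : sform ar) : sform ar :=
  alls (fo_vars vs) (SOr (is_zero ar (team_app f vs)) p).

(* All team variables lie below [N.+3]. *)
Definition value_vars (xs : seq 'I_N) : seq nat := iota N.+3 (size xs).

(* The function [j] is the marginal distribution of [xs]; each of its values is the total
   mass of the restriction [j.+1] of the team [f] to the assignments with that value. *)
Definition entropy_form (xs vs : seq 'I_N) (f h j : nat) : sform ar :=
  let ys := value_vars xs in
  SExF j (size xs) (SAnd
    (alls ys (SExF j.+1 (size vs) (SAnd
       (alls (fo_vars vs)
          (SOr (SAnd (eqs ar (fo_vars xs) ys)
                     (SEqT ar (team_app j.+1 vs) (team_app f vs)))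
               (SAnd (neqs ar (fo_vars xs) ys) (is_zero ar (team_app j.+1 vs)))))
       (sums_is ar (fo_vars vs) (team_app j.+1 vs) (TApp j ys) j.+2))))
    (sums_is ar ys (TMul (TApp j ys) (TLog (TApp j ys))) (TApp h [::]) j.+1)).

(** With no subtraction at hand, [k'] plays the part of [1 - k]; its nonnegativity is the bound
    [k <= 1]. *)
Definition mixture_form (vs : seq 'I_N) (f f1 f2 j : nat) : sform ar :=
  let k := TApp j [::] in let k' := TApp j.+1 [::] in let o := TApp j.+2 [::] in
  SExF j 0 (SExF j.+1 0 (SExF j.+2 0 (SAnd (is_one ar o) (SAnd (SEqT ar (TAdd k k') o)
  (SAnd (nonneg ar k j.+3) (SAnd (nonneg ar k' j.+3)
  (alls (fo_vars vs) (SEqT ar (team_app f vs)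
     (TAdd (TMul k (team_app f1 vs)) (TMul k' (team_app f2 vs))))))))))).

(** [f] names the current team and the symbols from [j] on are fresh. In the entropy case the
    nullary [j] is the negated common entropy. The teams guessed for quantifiers are normalised by
    the mass condition itself. *)
Fixpoint translate (phi : fform ar N) (vs : seq 'I_N) (f j : nat) : sform ar :=
  match phi with
  | FEq x y => literal_form vs f (SEqV ar (fo_var x) (fo_var y))
  | FNeq x y => literal_form vs f (SNeqV ar (fo_var x) (fo_var y))
  | FRel r xs => literal_form vs f (SRel (map_tuple (@fo_var N) xs))
  | FNRel r xs => literal_form vs f (SNRel (map_tuple (@fo_var N) xs))
  | FH xs ys => SExF j 0 (SAnd (entropy_form xs vs f j j.+1) (entropy_form ys vs f j j.+1))
  | FAnd p q => SAnd (translate p vs f j) (translate q vs f j)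
  | FOr p q => SExF j (size vs) (SExF j.+1 (size vs)
      (SAnd (is_team_form ar vs j j.+2) (SAnd (is_team_form ar vs j.+1 j.+2)
      (SAnd (mixture_form vs f j j.+1 j.+2)
      (SAnd (translate p vs j j.+2) (translate q vs j.+1 j.+2))))))
  | FEx x p => let vs' := add_var x vs in SExF j (size vs')
      (SAnd (alls (fo_vars vs') (nonneg ar (team_app j vs') j.+1))
      (SAnd (alls (fo_vars vs') (SExF j.+1 0
         (SAnd (forget_eq ar x vs f (TApp j.+1 [::]) j.+2)
               (sum_is ar (fo_var x) (team_app j vs') (TApp j.+1 [::]) j.+2))))
      (translate p vs' j j.+1)))
  (* Summing over the dummy variable 2 multiplies the weight of the new team by |A|. *)
  | FAll x p => let vs' := add_var x vs in SExF j (size vs')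
      (SAnd (alls (fo_vars vs') (SExF j.+1 0
         (SAnd (forget_eq ar x vs f (TApp j.+1 [::]) j.+2)
               (sum_is ar 2 (team_app j vs') (TApp j.+1 [::]) j.+2))))
      (translate p vs' j j.+1))
  | FNot p => dual (translate p vs f j)
  end.

(** Universal function quantifiers arise through [dual] only, that is, from [FNot]. *)
Lemma is_ESO_translate phi vs f j : is_FOH phi -> is_ESO (translate phi vs f j).
Proof.
have ent xs ws g h k : is_ESO (entropy_form xs ws g h k).
  by rewrite /entropy_form /= !(is_ESO_alls, is_ESO_sums_is, is_ESO_eqs, is_ESO_neqs) /=
    !(is_ESO_alls, is_ESO_sums_is) /= is_ESO_eqs is_ESO_neqs.
have team ws g k : is_ESO (is_team_form ar ws g k).
  by rewrite /= is_ESO_alls is_ESO_sums_is.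
have mix ws g g1 g2 k : is_ESO (mixture_form ws g g1 g2 k).
  by rewrite /= is_ESO_alls.
have fgt x ws g u k : is_ESO (@forget_eq _ ar N x ws g u k).
  by rewrite /forget_eq; case: ifP.
elim: phi vs f j => [x y|x y|r xs|r xs|xs ys|p IHp q IHq|p IHp q IHq|x p IH|x p IH|//] vs f j.
- by move=> _; rewrite /= is_ESO_alls.
- by move=> _; rewrite /= is_ESO_alls.
- by move=> _; rewrite /= is_ESO_alls.
- by move=> _; rewrite /= is_ESO_alls.
- by move=> _; apply/andP; split; exact: ent.
- by move=> /andP[/IHp Hp /IHq Hq]; apply/andP; split.
- move=> /andP[/IHp Hp /IHq Hq]; do 2![apply/andP; split; first exact: team].
  by apply/and3P; split; first exact: mix.
- by move=> /IH Hp; rewrite /= !is_ESO_alls /= fgt Hp.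
- by move=> /IH Hp; rewrite /= is_ESO_alls /= fgt Hp.
Qed.

(** * Correctness of the translation *)

Section Correctness.
Variable A : structure ar.
Local Notation T := (dom A).
Local Notation asg := (asg N A).
Implicit Types (s : nat -> T) (rho : fenv A) (X : asg -> R) (vs xs : seq 'I_N) (u : asg).

Lemma ssat_literal s rho vs f X p (P : asg -> Prop) :
  supported vs X -> encodes rho f vs X ->
  (forall s', ssat s' rho p <-> P (asg_env vs s')) ->
  (forall u, X u != 0 -> P u) <-> ssat s rho (literal_form vs f p).
Proof.
move=> sX eX H; symmetry.
rewrite -(forall_supported s (vs := vs)) => [|u /(supported_eq0 sX)->]; last by rewrite eqxx.
apply: (@ssat_alls_team _ _ _ _ _ _ _ _ (fun u => X u != 0 -> P u)) => s' _.
change (ssat s' rho (is_zero ar (team_app f vs)) \/ ssat s' rho p <->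
  (X (asg_env vs s') != 0 -> P (asg_env vs s'))).
rewrite ssat_is_zero (teval_team_app _ eX) H; split=> [[->|//]|K]; first by rewrite eqxx.
by have [|/K] := eqVneq (X (asg_env vs s')) 0; [left|right].
Qed.

Lemma map_asg_env s vs xs : {subset xs <= vs} ->
  map (asg_env vs s) xs = map Some (map s (fo_vars xs)).
Proof.
by move=> sub; rewrite -!map_comp; apply/eq_in_map => i /sub ivs; rewrite /= ffunE ivs.
Qed.

Lemma lit_rel_asg_env s vs r (xs : (ar r).-tuple 'I_N) b : {subset xs <= vs} ->
  lit_rel (asg_env vs s) xs b <-> Defs.rel (map_tuple s (map_tuple (@fo_var N) xs)) = b.
Proof.
move=> sub; rewrite /lit_rel map_asg_env //; split=> [[t [/map_Some_inj E <-]]|E].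
  by congr Defs.rel; apply: val_inj.
by exists (map_tuple s (map_tuple (@fo_var N) xs)).
Qed.

Lemma value_vars_fresh xs vs y : y \in value_vars xs -> y \notin fo_vars vs.
Proof.
rewrite mem_iota => /andP[Ny _]; apply/mapP=> -[i _ E].
by move: Ny; rewrite E /fo_var !ltnS leqNgt ltn_ord.
Qed.

Lemma value_vars_gt1 xs y : y \in value_vars xs -> (1 < y)%N.
Proof. by rewrite mem_iota => /andP[Ny _]; apply: leq_trans Ny. Qed.

(** The guessed function is forced to be the restriction [Z] of [X] to the assignments giving [xs]
    the values held by [ys]; its total mass is the marginal by definition. *)
Lemma ssat_marginal s rho xs vs f g j X m :
  uniq vs -> {subset xs <= vs} -> supported vs X -> encodes rho f vs X ->
  (f < j)%N -> (g < j)%N -> rho g = (size xs, m) ->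
  let ys := value_vars xs in
  ssat s rho (SExF j (size vs) (SAnd
       (alls (fo_vars vs)
          (SOr (SAnd (eqs ar (fo_vars xs) ys)
                     (SEqT ar (team_app j vs) (team_app f vs)))
               (SAnd (neqs ar (fo_vars xs) ys) (is_zero ar (team_app j vs)))))
       (sums_is ar (fo_vars vs) (team_app j vs) (TApp g ys) j.+1))) <->
  marg X xs (map s ys) = m (map s ys).
Proof.
move=> uvs sub sX eX fj gj Eg ys.
have fj' : f != j by rewrite ltn_eqF.
have gj' : g != j by rewrite ltn_eqF.
pose Z u := if map u xs == map Some (map s ys) then X u else 0.
rewrite (@ssat_ex_team _ _ _ _ _ _ _ _ _
  (fun Y => Y = Z /\ \sum_u Y u = m (map s ys)) uvs).
  split=> [[_ [_ [->]]]//|H]; exists Z; split=> // u.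
  by rewrite /Z; case: ifP => [_ /sX//|_]; rewrite eqxx.
move=> v Y sY eY.
have eX' : encodes (fupd rho j v) f vs X by apply: encodes_fupd.
have H2 : ssat s (fupd rho j v)
    (sums_is ar (fo_vars vs) (team_app j vs) (TApp g ys) j.+1) <->
    \sum_u Y u = m (map s ys).
  rewrite ssat_sums_is ?(map_inj_uniq (@fo_var_inj N)) ?fo_vars_gt1 //; last 3 first.
  - exact: tvar_team_app.
  - move=> y yys; rewrite (value_vars_fresh _ yys) andbT.
    exact: value_vars_gt1 yys.
  - by move=> h /orP[/eqP<-//|/eqP<-]; rewrite ltnW.
  rewrite [teval s _ _]/= fupd_other // Eg /= size_iota eqxx (sum_supported s uvs sY).
  rewrite (_ : (fun s0 => _) = (fun s0 => Y (asg_env vs s0))) //.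
  by apply: funext => s0; apply/teval_team_app.
have H1 : ssat s (fupd rho j v) (alls (fo_vars vs)
          (SOr (SAnd (eqs ar (fo_vars xs) ys)
                     (SEqT ar (team_app j vs) (team_app f vs)))
               (SAnd (neqs ar (fo_vars xs) ys) (is_zero ar (team_app j vs))))) <->
    Y = Z.
  have -> : (Y = Z) <-> forall u, Y u = Z u.
    by split=> [->|/funext].
  rewrite -(forall_supported s (vs := vs)) => [|u du]; last first.
    by rewrite /Z (supported_eq0 sX du) (supported_eq0 sY du) if_same.
  apply: (@ssat_alls_team _ _ _ _ _ _ _ _ (fun u => Y u = Z u)) => s' Es'.
  change ((ssat s' (fupd rho j v) (eqs ar (fo_vars xs) ys) /\
           teval s' (fupd rho j v) (team_app j vs) = teval s' (fupd rho j v) (team_app f vs)) \/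
          (ssat s' (fupd rho j v) (neqs ar (fo_vars xs) ys) /\
           ssat s' (fupd rho j v) (is_zero ar (team_app j vs))) <->
          Y (asg_env vs s') = Z (asg_env vs s')).
  rewrite ssat_is_zero (teval_team_app _ eX') (teval_team_app _ eY).
  have sz : size (fo_vars xs) = size ys by rewrite size_map size_iota.
  rewrite ssat_eqs // ssat_neqs // /Z map_asg_env //.
  (* The block over the team variables does not rebind the value variables. *)
  have -> : map s ys = map s' ys.
    by apply/eq_in_map => y yys; rewrite Es' // (value_vars_fresh _ yys).
  rewrite (inj_eq (@map_Some_inj T)); case: eqP => E.
    by split=> [[[]|[]]//|]; left.
  by split=> [[[]|[]]//|]; right.
by rewrite /= in H1 H2 *; rewrite H1 H2.
Qed.

(** The guessed function is forced to be the marginal distribution. The formula states the sum of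
    [P log P] without its sign, hence the minus in front of [w]. *)
Lemma ssat_entropy s rho xs vs f h j X w :
  uniq vs -> {subset xs <= vs} -> supported vs X -> encodes rho f vs X ->
  (f < j)%N -> (h < j)%N -> rho h = (0%N, w) ->
  ssat s rho (entropy_form xs vs f h j) <-> entropy X xs = - w [::].
Proof.
move=> uvs sub sX eX fj hj Eh; set ys := value_vars xs.
have uys : uniq ys by exact: iota_uniq.
have fj' : f != j by rewrite ltn_eqF.
have hj' : h != j by rewrite ltn_eqF.
have ys1 y : y \in ys -> (1 < y)%N by exact: value_vars_gt1.
have H2 m : ssat s (fupd rho j (size xs, m))
    (sums_is ar ys (TMul (TApp j ys) (TLog (TApp j ys))) (TApp h [::]) j.+1) <->
    \sum_(a : (size xs).-tuple T) m a * log2 (m a) = w [::].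
  rewrite ssat_sums_is //; last 3 first.
  - by apply/allP.
  - by move=> y /orP[]; exact: ys1.
  - by move=> g; rewrite /= orbb => /orP[/eqP<-//|/eqP<-]; rewrite ltnW.
  rewrite (@iter_sum_tuple _ _ _ (size xs)) ?size_iota //=.
  rewrite [fupd rho j _ h]fupd_other // Eh /=.
  rewrite (eq_bigr (fun a : (size xs).-tuple T => m a * log2 (m a))) // => a _.
  by rewrite fupd_same /= size_iota eqxx map_supds ?size_iota ?size_tuple // RmultE.
have H1 m : ssat s (fupd rho j (size xs, m)) (alls ys (SExF j.+1 (size vs) (SAnd
       (alls (fo_vars vs)
          (SOr (SAnd (eqs ar (fo_vars xs) ys)
                     (SEqT ar (team_app j.+1 vs) (team_app f vs)))
               (SAnd (neqs ar (fo_vars xs) ys) (is_zero ar (team_app j.+1 vs)))))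
       (sums_is ar (fo_vars vs) (team_app j.+1 vs) (TApp j ys) j.+2)))) <->
     forall a : (size xs).-tuple T, marg X xs a = m a.
  rewrite ssat_alls.
  have K s' : _ <-> _ := @ssat_marginal s' (fupd rho j (size xs, m)) xs vs f j j.+1 X m uvs sub sX
    (encodes_fupd _ fj' eX) (ltnW fj) (ltnSn j) (fupd_same _ _ _).
  split=> [H a|H s' _].
    have := proj1 (K _) (H (supds s ys a) (fun x => @supds_other _ _ _ s ys a x)).
    by rewrite map_supds ?size_iota ?size_tuple.
  apply/K; have sz : size (map s' ys) == size xs by rewrite size_map size_iota.
  exact: (H (Tuple sz)).
have entE : entropy X xs = - \sum_(a : (size xs).-tuple T) marg X xs a * log2 (marg X xs a).
  by rewrite /entropy RoppE.
rewrite entE; split=> [[m [/H1 Em /H2<-]]|/oppr_inj Ew].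
  by congr (- _); apply: eq_bigr => a _; rewrite Em.
by exists (marg X xs); split; [apply/H1|apply/H2].
Qed.

Lemma ssat_mixture s rho vs f f1 f2 j X Y Z :
  (f < j)%N -> (f1 < j)%N -> (f2 < j)%N ->
  supported vs X -> supported vs Y -> supported vs Z ->
  encodes rho f vs X -> encodes rho f1 vs Y -> encodes rho f2 vs Z ->
  ssat s rho (mixture_form vs f f1 f2 j) <->
  exists2 k : R, 0 <= k <= 1 & forall u, X u = k * Y u + (1 - k) * Z u.
Proof.
move=> fj f1j f2j sX sY sZ eX eY eZ.
have K k k' o (r := fupd (fupd (fupd rho j (0%N, k)) j.+1 (0%N, k')) j.+2 (0%N, o)) :
   ssat s r (SAnd (is_one ar (TApp j.+2 [::]))
    (SAnd (SEqT ar (TAdd (TApp j [::]) (TApp j.+1 [::])) (TApp j.+2 [::]))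
    (SAnd (nonneg ar (TApp j [::]) j.+3) (SAnd (nonneg ar (TApp j.+1 [::]) j.+3)
    (alls (fo_vars vs) (SEqT ar (team_app f vs)
     (TAdd (TMul (TApp j [::]) (team_app f1 vs))
           (TMul (TApp j.+1 [::]) (team_app f2 vs)))))))))
  <-> [/\ o [::] = 1, k [::] + k' [::] = o [::], 0 <= k [::], 0 <= k' [::] &
          forall u, X u = k [::] * Y u + k' [::] * Z u].
  have eqS n : (n == n.+1) = false by rewrite eqn_leq ltnn andbF.
  have eqSS n : (n == n.+2) = false by rewrite ltn_eqF // ltnW.
  have eqSSS n : (n == n.+3) = false by lia.
  have rk s' : teval s' r (TApp j [::]) = k [::].
    have E : r j = (0%N, k) by rewrite /r fupd_other ?eqSS // fupd_other ?eqS // fupd_same.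
    by rewrite /= E.
  have rk' s' : teval s' r (TApp j.+1 [::]) = k' [::].
    have E : r j.+1 = (0%N, k') by rewrite /r fupd_other ?fupd_same ?eqS.
    by rewrite /= E.
  have ro s' : teval s' r (TApp j.+2 [::]) = o [::].
    have E : r j.+2 = (0%N, o) by rewrite /r fupd_same.
    by rewrite /= E.
  have er g W : (g < j)%N -> encodes rho g vs W -> encodes r g vs W.
    by move=> gj eW; rewrite /r; do 3![apply: encodes_fupd; first by lia].
  have H5 : ssat s r (alls (fo_vars vs) (SEqT ar (team_app f vs)
     (TAdd (TMul (TApp j [::]) (team_app f1 vs))
           (TMul (TApp j.+1 [::]) (team_app f2 vs))))) <->
     forall u, X u = k [::] * Y u + k' [::] * Z u.
    rewrite -(forall_supported s (vs := vs)) => [|u du]; last first.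
      by rewrite (supported_eq0 sX du) (supported_eq0 sY du) (supported_eq0 sZ du) !mulr0 addr0.
    apply: (@ssat_alls_team _ _ _ _ _ _ _ _ (fun u => X u = k [::] * Y u + k' [::] * Z u)) => s' _.
    rewrite -(teval_team_app s' (er _ _ fj eX)) -(teval_team_app s' (er _ _ f1j eY)).
    by rewrite -(teval_team_app s' (er _ _ f2j eZ)) -(rk s') -(rk' s').
  have H1 : ssat s r (is_one ar (TApp j.+2 [::])) <-> o [::] = 1.
    by rewrite ssat_is_one ro.
  have H2 : ssat s r (SEqT ar (TAdd (TApp j [::]) (TApp j.+1 [::])) (TApp j.+2 [::])) <->
      k [::] + k' [::] = o [::].
    by rewrite -(rk s) -(rk' s) -(ro s).
  have H3 : ssat s r (nonneg ar (TApp j [::]) j.+3) <-> 0 <= k [::].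
    by rewrite ssat_nonneg ?rk //= eqSSS.
  have H4 : ssat s r (nonneg ar (TApp j.+1 [::]) j.+3) <-> 0 <= k' [::].
    by rewrite ssat_nonneg ?rk' //= eqSS.
  split=> [[/H1 h1 [/H2 h2 [/H3 h3 [/H4 h4 /H5 h5]]]]//|[/H1 h1 /H2 h2 /H3 h3 /H4 h4 /H5 h5]].
  by split; last split; last split; last split.
split=> [[k [k' [o /K[Eo Ekk k0 k'0 EX]]]]|[k /andP[k0 k1] EX]].
  have Ek' : k' [::] = 1 - k [::] by rewrite -Eo -Ekk addrC addKr.
  exists (k [::]); last by move=> u; rewrite EX Ek'.
  by rewrite k0 /= -subr_ge0 -Ek'.
exists (fun _ => k), (fun _ => 1 - k), (fun _ => 1); apply/K; split=> //.
  by rewrite addrC subrK.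
by rewrite subr_ge0.
Qed.

Lemma forget_local x vs X s s' :
  {in add_var x vs, forall i, s (fo_var i) = s' (fo_var i)} ->
  forget x vs X s = forget x vs X s'.
Proof.
move=> E; have E' b : asg_env vs (supd s (fo_var x) b) = asg_env vs (supd s' (fo_var x) b).
  apply: eq_asg_env => i ivs; rewrite /supd; case: eqP => // _.
  by apply: E; rewrite mem_add_var ivs orbT.
rewrite /forget; case: ifPn => [_|xvs]; first by apply: eq_bigr => b _; rewrite E'.
by rewrite -(asg_env_supd s (s 0%N) xvs) E' asg_env_supd.
Qed.

(** Shared by both team quantifiers. For the existential one [y] is the variable [x] itself and [h]
    runs through a class off [x]; for the universal one [y] is the dummy 2 and [h] ignores its
    second argument. *)
Lemma ssat_mass_transfer s rho x y vs f j Y X (h : asg -> T -> R) :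
  (1 < y)%N -> (f < j)%N -> encodes rho f vs X -> encodes rho j (add_var x vs) Y ->
  (forall s a, Y (asg_env (add_var x vs) (supd s y a)) = h (asg_env (add_var x vs) s) a) ->
  ssat s rho (alls (fo_vars (add_var x vs)) (SExF j.+1 0
         (SAnd (forget_eq ar x vs f (TApp j.+1 [::]) j.+2)
               (sum_is ar y (team_app j (add_var x vs)) (TApp j.+1 [::]) j.+2)))) <->
  forall s', \sum_a h (asg_env (add_var x vs) s') a = forget x vs X s'.
Proof.
move=> y1 fj eX eY Eh.
have fj1 : f != j.+1 by rewrite ltn_eqF // ltnW.
have jj1 : j != j.+1 by rewrite ltn_eqF.
have H1 s1 g : ssat s1 (fupd rho j.+1 (0%N, g)) (forget_eq ar x vs f (TApp j.+1 [::]) j.+2)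
    <-> forget x vs X s1 = g [::].
  rewrite (ssat_forget_eq _ _ _ _ (encodes_fupd _ fj1 eX)) //; last by lia.
  by rewrite [teval _ _ _]/= fupd_same.
have H2 s1 g : ssat s1 (fupd rho j.+1 (0%N, g))
    (sum_is ar y (team_app j (add_var x vs)) (TApp j.+1 [::]) j.+2)
    <-> \sum_a h (asg_env (add_var x vs) s1) a = g [::].
  rewrite ssat_sum_is //; last 2 first.
  - exact: tvar_team_app.
  - by move=> k /orP[/eqP<-|/eqP<-//]; rewrite ltnW.
  rewrite (eq_bigr (h (asg_env (add_var x vs) s1))) => [|a _].
    by rewrite /= fupd_same.
  by rewrite (teval_team_app _ (encodes_fupd _ jj1 eY)).
rewrite ssat_alls; split=> [H s'|H s' _]; last first.
  by exists (fun _ => forget x vs X s'); split; [apply/H1|apply/H2].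
pose s'' z := if z \in fo_vars (add_var x vs) then s' z else s z.
have E : {in add_var x vs, forall i, s' (fo_var i) = s'' (fo_var i)}.
  by move=> i ivs; rewrite /s'' mem_fo_vars ivs.
case: (H s'') => [z /negbTE zx|g [/H1 h1 /H2 h2]]; first by rewrite /s'' zx.
by rewrite (eq_asg_env E) h2 -h1; apply/esym/forget_local.
Qed.

(** Induction on [phi] for all variable lists, teams and environments at once. The bound [f < j]
    keeps the current team intact under later guesses. *)
Lemma translate_correct phi vs f j X s rho :
  uniq vs -> fv phi \subset [set i in vs] -> (f < j)%N ->
  is_team [set i in vs] X -> encodes rho f vs X ->
  sat [set i in vs] phi X <-> ssat s rho (translate phi vs f j).
Proof.
elim: phi vs f j X s rho =>
  [x y|x y|r xs|r xs|xs ys|p IHp q IHq|p IHp q IHq|x p IH|x p IH|p IH] vs f j X s rho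
  uvs sub fj tX eX; have sX := is_team_supported tX.
- have [xvs yvs] : x \in vs /\ y \in vs.
    by split; have := subsetP sub; [move/(_ x)|move/(_ y)]; rewrite !inE eqxx ?orbT; apply.
  apply: ssat_literal => // s'; rewrite /lit_eq !ffunE xvs yvs.
  by split=> [/= ->//|[_ []]].
- have [xvs yvs] : x \in vs /\ y \in vs.
    by split; have := subsetP sub; [move/(_ x)|move/(_ y)]; rewrite !inE eqxx ?orbT; apply.
  apply: ssat_literal => // s'; rewrite /lit_neq !ffunE xvs yvs.
  by split=> [/= H|[_ [_ H]] /= E]; [split=> //; split=> // -[]|apply: H; rewrite E].
- have xsvs : {subset xs <= vs} by move=> i ixs; have := subsetP sub i; rewrite !inE; apply.
  by apply: ssat_literal => // s'; rewrite lit_rel_asg_env.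
- have xsvs : {subset xs <= vs} by move=> i ixs; have := subsetP sub i; rewrite !inE; apply.
  by apply: ssat_literal => // s'; rewrite lit_rel_asg_env //=; split=> [/negbTE|->].
- have [xsvs ysvs] : {subset xs <= vs} /\ {subset ys <= vs}.
    by split=> i ixs; have := subsetP sub i; rewrite !inE mem_cat ixs ?orbT; apply.
  have fj' : f != j by rewrite ltn_eqF.
  have K zs w : {subset zs <= vs} ->
      ssat s (fupd rho j (0%N, w)) (entropy_form zs vs f j j.+1) <->
      entropy X zs = - w [::].
    move=> zsvs; apply: ssat_entropy => //; first exact: encodes_fupd.
      exact: ltnW.
    exact: fupd_same.
  split=> [/= E|[w [Hx Hy]]]; last first.
    by rewrite /= (proj1 (K _ _ xsvs) Hx) (proj1 (K _ _ ysvs) Hy).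
  (* The shared nullary function takes the negated entropy as its value. *)
  by exists (fun _ => - entropy X xs); split; apply/K; rewrite // opprK.
- have /andP[sp sq] : (fv p \subset [set i in vs]) && (fv q \subset [set i in vs]).
    by rewrite -subUset.
  by rewrite /= (IHp vs f j X s rho) // (IHq vs f j X s rho).
- have /andP[sp sq] : (fv p \subset [set i in vs]) && (fv q \subset [set i in vs]).
    by rewrite -subUset.
  have H : ssat s rho (translate (FOr p q) vs f j) <-> exists Y, supported vs Y /\
     exists Z, supported vs Z /\
     [/\ is_team [set i in vs] Y, is_team [set i in vs] Z,
         exists2 k : R, 0 <= k <= 1 & forall u, X u = k * Y u + (1 - k) * Z u,
         sat [set i in vs] p Y & sat [set i in vs] q Z].
    apply: ssat_ex_team => // v Y sY eY; apply: ssat_ex_team => // w Z sZ eZ.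
    have eX' : encodes (fupd (fupd rho j v) j.+1 w) f vs X.
      by do 2![apply: encodes_fupd; first by rewrite ltn_eqF // ltnW].
    have eY' : encodes (fupd (fupd rho j v) j.+1 w) j vs Y.
      by apply: encodes_fupd => //; rewrite ltn_eqF.
    have [fj2 jj2 jj1] : [/\ f < j.+2, j < j.+2 & j.+1 < j.+2]%N by split; lia.
    have HY := ssat_is_team s uvs jj2 sY eY'.
    have HZ := ssat_is_team s uvs jj1 sZ eZ.
    have HM := ssat_mixture s fj2 jj2 jj1 sX sY sZ eX' eY' eZ.
    split=> [[/HY tY [/HZ tZ [/HM M [Hp Hq]]]]|[tY tZ M Hp Hq]].
      split=> //; first exact: (proj2 (IHp _ _ _ _ s _ uvs sp jj2 tY eY') Hp).
      exact: (proj2 (IHq _ _ _ _ s _ uvs sq jj1 tZ eZ) Hq).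
    split; first exact/HY; split; first exact/HZ; split; first exact/HM.
    split; first exact: (proj1 (IHp _ _ _ _ s _ uvs sp jj2 tY eY') Hp).
    exact: (proj1 (IHq _ _ _ _ s _ uvs sq jj1 tZ eZ) Hq).
  rewrite H; split=> [[Y [Z [k [[tY tZ] k01 XE Hp Hq]]]]|].
    exists Y; split; first exact: is_team_supported.
    by exists Z; split; [exact: is_team_supported|split=> //; exists k].
  by move=> [Y [_ [Z [_ [tY tZ [k k01 XE] Hp Hq]]]]]; exists Y, Z, k.
- have sub' : fv p \subset [set i in add_var x vs] by rewrite set_add_var -subDset.
  have uvs' := uniq_add_var x uvs.
  have H : ssat s rho (translate (FEx x p) vs f j) <-> exists Y,
     supported (add_var x vs) Y /\
     [/\ forall u, 0 <= Y u,
      forall s, \sum_a Y (asg_env (add_var x vs) (supd s (fo_var x) a)) = forget x vs X s &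
      sat [set i in add_var x vs] p Y].
    apply: ssat_ex_team => // v Y sY eY.
    have eX' : encodes (fupd rho j v) f vs X.
      by apply: encodes_fupd => //; rewrite ltn_eqF.
    have H1 : ssat s (fupd rho j v) (alls (fo_vars (add_var x vs))
        (nonneg ar (team_app j (add_var x vs)) j.+1)) <-> forall u, 0 <= Y u.
      rewrite -(forall_supported s (vs := add_var x vs)) => [|u /(supported_eq0 sY)->//].
      apply: (@ssat_alls_team _ _ _ _ _ _ _ _ (fun u => 0 <= Y u)) => s' _.
      by rewrite ssat_nonneg ?(teval_team_app _ eY) //= ltn_eqF.
    have updE s' a : upd (asg_env (add_var x vs) s') x a =
        asg_env (add_var x vs) (supd s' (fo_var x) a).
      by rewrite upd_asg_env {1}/add_var mem_add_var eqxx.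
    have YE : (forall s', \sum_a Y (upd (asg_env (add_var x vs) s') x a) = forget x vs X s') <->
        forall s', \sum_a Y (asg_env (add_var x vs) (supd s' (fo_var x) a)) = forget x vs X s'.
      by split=> K s'; rewrite -K; apply: eq_bigr => a _; rewrite updE.
    have H2 := iff_trans (ssat_mass_transfer s (h := fun u a => Y (upd u x a))
      (isT : 1 < fo_var x)%N fj eX' eY (fun s' a => congr1 Y (esym (updE s' a)))) YE.
    (* The first two conjuncts already make [Y] an extension of [X], hence a team, as the induction
       hypothesis requires. *)
    have tY : (forall u, 0 <= Y u) ->
       (forall s, \sum_a Y (asg_env (add_var x vs) (supd s (fo_var x) a)) = forget x vs X s) ->
       is_team [set i in add_var x vs] Y.
      by move=> Y0 /(ext_of_mass s sX sY Y0)[F wF ->]; apply: ext_is_team.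
    split=> [[/H1 h1 [/H2 h2 h3]]|[h1 h2 h3]].
      split=> //; exact: (proj2 (IH _ _ _ _ s _ uvs' sub' (ltnSn j) (tY h1 h2) eY) h3).
    split; first exact/H1; split; first exact/H2.
    exact: (proj1 (IH _ _ _ _ s _ uvs' sub' (ltnSn j) (tY h1 h2) eY) h3).
  rewrite H; split=> [[F [wF]]|[Y [sY [Y0 YX Hp]]]].
    rewrite -set_add_var => Hp; exists (ext X x F); split; first exact: ext_supported.
    split=> //; first by case: (ext_is_team x tX wF).
    by move=> s'; apply: ext_mass => // u; case: (wF u).
  have [F wF EY] := ext_of_mass s sX sY Y0 YX.
  by exists F; split=> //; rewrite -set_add_var -EY.
- have sub' : fv p \subset [set i in add_var x vs] by rewrite set_add_var -subDset.
  have uvs' := uniq_add_var x uvs.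
  have T0 : #|T|%:R != 0 :> R.
    by rewrite pnatr_eq0 -lt0n; apply/card_gt0P; exists (s 0%N).
  have sE : supported (add_var x vs) (ext_all X x) by exact: ext_supported.
  have tE : is_team [set i in add_var x vs] (ext_all X x).
    apply: ext_is_team => // u; split=> [a|]; first by rewrite invr_ge0 ler0n.
    by rewrite sumr_const -[_ *+ _]mulr_natr mulVf.
  have H : ssat s rho (translate (FAll x p) vs f j) <-> exists Y,
     supported (add_var x vs) Y /\
     (Y = ext_all X x /\ sat [set i in add_var x vs] p Y).
    apply: ssat_ex_team => // v Y sY eY.
    have eX' : encodes (fupd rho j v) f vs X.
      by apply: encodes_fupd => //; rewrite ltn_eqF.
    (* The variable 2 codes no team variable, so [Y] is constant in it. *)
    have Y2 s' a : Y (asg_env (add_var x vs) (supd s' 2 a)) = Y (asg_env (add_var x vs) s').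
      by congr Y; apply: eq_asg_env.
    (* The constant sum is the cardinality of the universe times [Y]; dividing by it gives the
       uniform extension. *)
    have YE : (forall s', \sum_(a : T) Y (asg_env (add_var x vs) s') = forget x vs X s') <->
        Y = ext_all X x.
      split=> [K|-> s']; last first.
        by rewrite (ext_all_asg_env _ _ sX) sumr_const -[_ *+ _]mulr_natr divfK.
      apply: funext; apply/(forall_supported s (vs := add_var x vs)) => [u du|s'].
        by rewrite (supported_eq0 sY) // (supported_eq0 sE).
      by rewrite (ext_all_asg_env _ _ sX) -K sumr_const -[_ *+ _]mulr_natr mulfK.
    have H2 := iff_trans (ssat_mass_transfer s (h := fun u _ => Y u)
      (isT : 1 < 2)%N fj eX' eY Y2) YE.
    have K := fun tY => IH _ _ _ _ s _ uvs' sub' (ltnSn j) tY eY.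
    split=> [[/H2 h2 h3]|[h2 h3]].
      by split=> //; apply/K => //; rewrite h2.
    by split; [exact/H2|apply/K => //; rewrite h2].
  rewrite H; split=> [|[Y [_ [-> ]]]]; rewrite set_add_var //.
  by move=> Hp; exists (ext_all X x).
- by rewrite /= ssat_dual (IH vs f j X s rho).
Qed.

End Correctness.
End Translation.

(** * Binding the remaining free variables *)

Section Closing.
Variables (sym : Type) (ar : sym -> nat).

Lemma free_var_bound (p : sform ar) : exists B, forall x, sfree_var p x -> (x < B)%N.
Proof.
have tb t : exists B, forall x, tvar t x -> (x < B)%N.
  elim: t => [f xs|t [B1 H1] u [B2 H2]|t [B1 H1] u [B2 H2]|//] /=.
  - exists (\max_(x <- xs) x).+1 => x xxs; rewrite ltnS; exact: (@leq_bigmax_seq _ _ xpredT id).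
  - by exists (maxn B1 B2) => x /orP[/H1|/H2]; rewrite leq_max => ->; rewrite ?orbT.
  - by exists (maxn B1 B2) => x /orP[/H1|/H2]; rewrite leq_max => ->; rewrite ?orbT.
have t2 t u : exists B, forall x, tvar t x || tvar u x -> (x < B)%N.
  exact: (tb (TAdd t u)).
elim: p => /= [t u|t u|x y|x y|r xs|r xs|p [B1 H1] q [B2 H2]|p [B1 H1] q [B2 H2]
  |x p [B H]|x p [B H]|//|//]; try exact: t2.
- by exists (maxn x y).+1 => z /orP[]/eqP->; rewrite ltnS leq_max leqnn ?orbT.
- by exists (maxn x y).+1 => z /orP[]/eqP->; rewrite ltnS leq_max leqnn ?orbT.
- exact: (tb (TApp 0 xs)).
- exact: (tb (TApp 0 xs)).
- by exists (maxn B1 B2) => x /orP[/H1|/H2]; rewrite leq_max => ->; rewrite ?orbT.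
- by exists (maxn B1 B2) => x /orP[/H1|/H2]; rewrite leq_max => ->; rewrite ?orbT.
- by exists B => y /andP[_ /H].
- by exists B => y /andP[_ /H].
Qed.

Lemma free_fun_bound (p : sform ar) : exists B, forall f, sfree_fun p f -> (f < B)%N.
Proof.
have tb t : exists B, forall f, tfun t f -> (f < B)%N.
  elim: t => [f xs|t [B1 H1] u [B2 H2]|t [B1 H1] u [B2 H2]|//] /=.
  - by exists f.+1 => g /eqP<-.
  - by exists (maxn B1 B2) => x /orP[/H1|/H2]; rewrite leq_max => ->; rewrite ?orbT.
  - by exists (maxn B1 B2) => x /orP[/H1|/H2]; rewrite leq_max => ->; rewrite ?orbT.
have t2 t u : exists B, forall x, tfun t x || tfun u x -> (x < B)%N.
  exact: (tb (TAdd t u)).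
elim: p => /= [t u|t u|x y|x y|r xs|r xs|p [B1 H1] q [B2 H2]|p [B1 H1] q [B2 H2]
  |//|//|f m p [B H]|f m p [B H]]; try exact: t2; try by exists 0%N.
- by exists (maxn B1 B2) => x /orP[/H1|/H2]; rewrite leq_max => ->; rewrite ?orbT.
- by exists (maxn B1 B2) => x /orP[/H1|/H2]; rewrite leq_max => ->; rewrite ?orbT.
- by exists B => y /andP[_ /H].
- by exists B => y /andP[_ /H].
Qed.

Lemma sfree_var_alls xs (p : sform ar) x :
  sfree_var (alls xs p) x = (x \notin xs) && sfree_var p x.
Proof. by elim: xs => //= y xs ->; rewrite inE negb_or andbA. Qed.

Lemma sfree_fun_alls xs (p : sform ar) f : sfree_fun (alls xs p) f = sfree_fun p f.
Proof. by elim: xs. Qed.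

Definition exfs (fs : seq nat) (p : sform ar) : sform ar :=
  foldr (fun f => SExF f 0) p fs.

Lemma sfree_var_exfs fs (p : sform ar) x : sfree_var (exfs fs p) x = sfree_var p x.
Proof. by elim: fs. Qed.

Lemma sfree_fun_exfs fs (p : sform ar) f :
  sfree_fun (exfs fs p) f = (f \notin fs) && sfree_fun p f.
Proof. by elim: fs => //= y xs ->; rewrite inE negb_or andbA. Qed.

Lemma is_ESO_exfs fs (p : sform ar) : is_ESO (exfs fs p) = is_ESO p.
Proof. by elim: fs. Qed.

(* If the truth of [p] depends only on the value of the function variable 0, its other
   free variables may be bound by arbitrary quantifiers. *)
Lemma close_formula (p : sform ar) : exists q : sform ar,
  [/\ is_ESO q = is_ESO p, one_free_fun q &
   forall (A : structure ar) (v : nat * (seq (dom A) -> R)) (Q : Prop),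
     (forall s rho, rho 0%N = v -> ssat s rho p <-> Q) ->
     forall s rho, rho 0%N = v -> ssat s rho q <-> Q].
Proof.
have [B1 H1] := free_var_bound p; have [B2 H2] := free_fun_bound p.
(* Function symbol 0 is spared because the second list starts at 1. Existential function quantifiers
   keep the formula in the existential fragment. *)
exists (alls (iota 0 B1) (exfs (iota 1 B2) p)); split.
- by rewrite is_ESO_alls is_ESO_exfs.
- split=> [x|f].
    rewrite sfree_var_alls sfree_var_exfs mem_iota /=.
    by apply/negP=> /andP[xB /H1]; rewrite add0n in xB *; rewrite (negbTE xB).
  rewrite sfree_fun_alls sfree_fun_exfs mem_iota; case: f => // f /andP[+ /H2 fB].
  by rewrite /= add1n ltnS ltnW.
move=> A v Q pQ s rho r0; rewrite ssat_alls.
have {pQ}qQ s' rho' : rho' 0%N = v -> ssat s' rho' (exfs (iota 1 B2) p) <-> Q.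
  have : 0%N \notin iota 1 B2 by rewrite mem_iota.
  elim: (iota 1 B2) rho' => [|f fs IH] rho' /=; first by move=> _; exact: pQ.
  rewrite inE negb_or => /andP[f0 fs0] r0'.
  have K g : ssat s' (fupd rho' f (0%N, g)) (exfs fs p) <-> Q.
    by apply: IH => //; rewrite fupd_other.
  by split=> [[g /K]//|/K HQ]; exists (fun _ => 0); apply: HQ.
split=> [H|HQ s' _]; last exact/qQ.
by apply/(qQ s rho) => //; apply: H.
Qed.

End Closing.

(** One formula serves both logics, its existential form being conditional on the absence of
    [FNot]. *)
Lemma smodels_translate (sym : Type) (ar : sym -> nat) (N k : nat) (vs : k.-tuple 'I_N)
    (phi : fform ar N) :
  uniq vs -> fv phi \subset [set x in vs] ->
  exists psi : sform ar,
    [/\ is_FOH phi -> is_ESO psi, one_free_fun psi &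
     forall (A : structure ar) (X : asg N A -> R),
       (0 < #|dom A|)%N -> is_team [set x in vs] X ->
       (sat [set x in vs] phi X <-> smodels k (f_team vs X) psi)].
Proof.
(* The team occupies function symbol 0, so the fresh symbols start at 1. *)
move=> uvs sub; have [psi [E1 E2 E3]] := close_formula (translate phi vs 0 1).
exists psi; split=> //; first by rewrite E1; apply: is_ESO_translate.
move=> A X /card_gt0P[a0 _] tX.
have H (s : nat -> dom A) (rho : fenv A) : rho 0%N = (k, f_team vs X) ->
    ssat s rho psi <-> sat [set x in vs] phi X.
  apply: E3 => {}s {}rho r0; symmetry; apply: translate_correct => //.
  split=> [|s']; first by rewrite r0 /= size_tuple.
  by rewrite r0 /= /f_team !size_map size_tuple eqxx asg_of_map.
split=> [Hs s rho r0|Hm]; first exact/H.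
(* [smodels] quantifies over environments; nonemptiness of the universe provides one to instantiate
   it. *)
by apply/(H (fun _ => a0) (fun _ => (k, f_team vs X))) => //; apply: Hm.
Qed.

Theorem mainTheorem9 (sym : Type) (ar : sym -> nat) :
  (* FO(H) <= ESO_R(+,x,log) *)
  (forall (N k : nat) (vs : k.-tuple 'I_N) (phi : fform ar N),
     uniq vs -> is_FOH phi -> fv phi \subset [set x in vs] ->
     exists psi : sform ar,
       is_ESO psi /\ one_free_fun psi /\
       forall (A : structure ar) (X : asg N A -> R),
         (0 < #|dom A|)%N -> is_team [set x in vs] X ->
         (sat [set x in vs] phi X <-> smodels k (f_team vs X) psi))
  /\
  (* FO(H,~) <= SO_R(+,x,log) *)
  (forall (N k : nat) (vs : k.-tuple 'I_N) (phi : fform ar N),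
     uniq vs -> fv phi \subset [set x in vs] ->
     exists psi : sform ar,
       one_free_fun psi /\
       forall (A : structure ar) (X : asg N A -> R),
         (0 < #|dom A|)%N -> is_team [set x in vs] X ->
         (sat [set x in vs] phi X <-> smodels k (f_team vs X) psi)).
Proof.
split=> N k vs phi uvs => [foh|] sub;
  have [psi [E1 E2 E3]] := smodels_translate uvs sub; exists psi => //.
by split; [exact: E1|split].
Qed.
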